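(* The collection $\mathcal{SMC}_{\mathcal Cat}$ of lax $\mathcal Cat$-span multicategories (objects), lax $\mathcal Cat$-span multifunctors (1-morphisms) and $\mathcal Cat$-span multinatural transformations (2-morphisms) is a 2-category, where the composition of $(F,\phi^I)$ with $(G,\psi^I)$ is the obvious one, $(G F,\ (G\phi^I)\cdot(\psi^I\,\boxdot^IF))$, and the vertical and horizontal compositions of 2-morphisms are the componentwise compositions of natural transformations.
   Context: **Trees.** $\mathcal O_{sk}$ is the category of sets $\mathbf n=\{1<\dots<n\}$, $n\ge0$, and non-decreasing maps; finite totally ordered sets (e.g. preimages) are identified with the isomorphic $\mathbf n$. $[I]=\{0\}\sqcup I$ with $0$ smallest. A tree is a functor $t:[I]\to\mathcal O_{sk}$ with $t(\max[I])=\mathbf1$; $t_h:t(h-1)\to t(h)$ are its structure maps. For $f:I\to J$ in $\mathcal O_{sk}$, $\psi=[f]:[J]\to[I]$, $\psi(y)=\max(\{0\}\cup\{x\in I\mid f(x)\le y\})$; $t_\psi=t\circ\psi$; for $g\in J$, $c\in t(\psi(g))$, $t^{|c}_{[\psi(g-1),\psi(g)]}$ is the tree whose levels $k\in[\psi(g-1),\psi(g)]$ are the preimages of $c$ in $t(k)$. **$\mathcal Cat$-span multiquivers.** For a category $\mathcal C$ put $\mathcal C^*=\bigsqcup_{n\ge0}\mathcal C^n$. Below a multiquiver over $\mathcal C$ is a category $\mathsf C$ with functors $\mathcal C^*\xleftarrow{\mathrm{src}}\mathsf C\xrightarrow{\mathrm{tgt}}\mathcal C$; then $\mathsf C=\bigsqcup_n\mathsf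 C(n)$, $\mathsf C(n)=\mathrm{src}^{-1}(\mathcal C^n)$. For multiquivers $\mathsf C_h$, $h\in I$, over $\mathcal C$, $\boxdot^{h\in I}\mathsf C_h$ is the multiquiver over $\mathcal C$ which is the disjoint union over trees $t:[I]\to\mathcal O_{sk}$ of the categories whose morphisms (and, in particular, objects) are pairs $(\ell,p)$ of families of morphisms (objects) $\ell=(\ell_h^b)_{h\in[I],b\in t(h)}$ of $\mathcal C$ and $p=(p_h^b)_{h\in I,b\in t(h)}$ with $p_h^b$ in $\mathsf C_h(t_h^{-1}b)$, such that $\mathrm{tgt}\,p_h^b=\ell_h^b$, $\mathrm{src}\,p_h^b=(\ell_{h-1}^a)_{a\in t_h^{-1}b}$; $\mathrm{src}(\ell,p)=(\ell_0^a)_{a\in t(0)}$, $\mathrm{tgt}(\ell,p)=\ell_{\max[I]}^1$. $\boxdot^I\mathsf C$ means all $\mathsf C_h=\mathsf C$ (so $\boxdot^\emptyset\mathsf C=\mathcal C$). $\mathrm P:\boxdot^{\mathbf1}\mathsf C\to\mathsf C$ is the obvious isomorphism. For $f:I\to J$ there is the regrouping isomorphism $\Lambda^f:\boxdot^I\mathsf C\to\boxdot^{j\in J}\boxdot^{f^{-1}j}\mathsf C$ sending $(t,\ell,p)$ to the tree $t_\psi$, restricted labels, and for $(g,c)$, $g\in J$, $c\in t_\psi(g)$, the tree $t^{|c}_{[\psi(g-1),\psi(g)]}$ with restricted $\ell,p$. **Lax $\mathcal Cat$-span multicategory** $(\mathsf C,\circledast^I,\lambda^f,\rho)$: a category ${}_{\mathsf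 t}\mathsf C=\mathcal C$, a multiquiver $\mathsf C$ over $\mathcal C$, for every $I\in\mathcal O_{sk}$ a functor $\circledast^I:\boxdot^I\mathsf C\to\mathsf C$ commuting with $\mathrm{src}$, $\mathrm{tgt}$; for every $f:I\to J$ in $\mathcal O_{sk}$, with $\circledast^f=\bigl(\boxdot^I\mathsf C\xrightarrow{\Lambda^f}\boxdot^{j\in J}\boxdot^{f^{-1}j}\mathsf C\xrightarrow{\boxdot^{j}\circledast^{f^{-1}j}}\boxdot^J\mathsf C\bigr)$, a natural transformation $\lambda^f:\circledast^I\to\circledast^J\circ\circledast^f$; and a natural transformation $\rho:\circledast^{\mathbf1}\to\mathrm P$; all these transformations are mapped to identities by $\mathrm{src}$ and $\mathrm{tgt}$. Axioms: (i) for all $I$, the composites $\circledast^I\xrightarrow{\lambda^{\mathrm{id}_I}}\circledast^I\circ\boxdot^{i\in I}\circledast^{\{i\}}\circ\Lambda^{\mathrm{id}}\xrightarrow{\circledast^I(\boxdot^i\rho)}\circledast^I$ and $\circledast^I\xrightarrow{\lambda^{I\to\mathbf1}}\circledast^{\mathbf1}\circ\boxdot^{\mathbf1}\circledast^I\circ\Lambda^{I\to\mathbf1}\xrightarrow{\rho}\circledast^I$ are identities; (ii) for $I\xrightarrow fJ\xrightarrow gK$, $(\lambda^g\circledast^f)\cdot\lambda^f=\bigl(\circledast^K\,\boxdot^{k\in K}\lambda^{f_k}\bigr)\cdot\lambda^{gf}:\circledast^I\to\circledast^K\circ\circledast^g\circ\circledast^f$ (first the right factor), where $f_k:f^{-1}g^{-1}k\to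 g^{-1}k$ is the restriction of $f$ and $\boxdot^{k}\lambda^{f_k}:\circledast^{gf}\to\circledast^g\circ\circledast^f$ applies $\lambda^{f_k}$ in each component after $\Lambda^{gf}$. **Lax $\mathcal Cat$-span multifunctor** $(F,\phi^I):\mathsf L\to\mathsf M$: functors ${}_{\mathsf t}F:{}_{\mathsf t}\mathsf L\to{}_{\mathsf t}\mathsf M$ and $F:\mathsf L\to\mathsf M$ with $\mathrm{src}\circ F=({}_{\mathsf t}F)^*\circ\mathrm{src}$, $\mathrm{tgt}\circ F={}_{\mathsf t}F\circ\mathrm{tgt}$, and natural transformations $\phi^I:\circledast_{\mathsf M}^I\circ\boxdot^IF\to F\circ\circledast_{\mathsf L}^I$, $I\in\mathcal O_{sk}$, mapped to identities by $\mathrm{src},\mathrm{tgt}$, such that $(F\rho_{\mathsf L})\cdot\phi^{\mathbf1}=\rho_{\mathsf M}\,\boxdot^{\mathbf1}F$, and for each $f:I\to J$ the composites $\circledast_{\mathsf M}^I\boxdot^IF\xrightarrow{\lambda^f_{\mathsf M}}\circledast_{\mathsf M}^J\circledast_{\mathsf M}^f\boxdot^IF\xrightarrow{\boxdot^{j}\phi^{f^{-1}j}}\circledast_{\mathsf M}^J(\boxdot^JF)\circledast_{\mathsf L}^f\xrightarrow{\phi^J}F\circledast_{\mathsf L}^J\circledast_{\mathsf L}^f$ and $\circledast_{\mathsf M}^I\boxdot^IF\xrightarrow{\phi^I}F\circledast_{\mathsf L}^I\xrightarrow{F\lambda_{\mathsf L}^f}F\circledast_{\mathsf L}^J\circledast_{\mathsf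 L}^f$ are equal. **$\mathcal Cat$-span multinatural transformation** $\xi:(F,\phi^I)\to(G,\psi^I):\mathsf L\to\mathsf M$: natural transformations ${}_{\mathsf t}\xi:{}_{\mathsf t}F\to{}_{\mathsf t}G$, $\xi:F\to G$ with $\mathrm{src}(\xi_X)=({}_{\mathsf t}\xi)^*_{\mathrm{src}X}$, $\mathrm{tgt}(\xi_X)={}_{\mathsf t}\xi_{\mathrm{tgt}X}$, and $\psi^I\cdot(\circledast_{\mathsf M}^I\,\boxdot^I\xi)=(\xi\,\circledast_{\mathsf L}^I)\cdot\phi^I:\circledast_{\mathsf M}^I\boxdot^IF\to G\circledast_{\mathsf L}^I$ for all $I\in\mathcal O_{sk}$. *)

(* Defs.v *)
From mathcomp Require Import all_boot.
From Stdlib Require Import FunctionalExtensionality ProofIrrelevance.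

Set Implicit Arguments.
Unset Strict Implicit.
Unset Printing Implicit Defensive.

(* Categories are given by a type of objects and a single type of morphisms with
   domain and codomain maps; composition takes a proof of composability.  In this
   form strict equations between functors and between morphisms (such as
   src (F x) = map u (src x)) are plain equations, without transport. *)

Record category := Category {
  Ob : Type;
  Mor : Type;
  dom : Mor -> Ob;
  cod : Mor -> Ob;
  idm : Ob -> Mor;
  cmp : forall g f : Mor, dom g = cod f -> Mor;
  dom_idm : forall x, dom (idm x) = x;
  cod_idm : forall x, cod (idm x) = x;
  dom_cmp : forall g f (e : dom g = cod f), dom (cmp e) = dom f;
  cod_cmp : forall g f (e : dom g = cod f), cod (cmp e) = cod g;
  cmp_idl : forall f (e : dom (idm (cod f)) = cod f), cmp e = f;
  cmp_idr : forall f (e : dom f = cod (idm (dom f))), cmp e = f;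
  cmpA : forall h g f (e1 : dom g = cod f) (e2 : dom h = cod (cmp e1))
    (e3 : dom h = cod g) (e4 : dom (cmp e3) = cod f), cmp e2 = cmp e4
}.

Arguments dom {_} _.
Arguments cod {_} _.
Arguments idm {_} _.
Arguments cmp {_} _ _ _.

Lemma cmp_congr (C : category) (g g' f f' : Mor C) e e' :
  g = g' -> f = f' -> cmp g f e = cmp g' f' e'.
Proof.
by move=> eg ef; subst g' f'; rewrite (proof_irrelevance _ e e').
Qed.

Record functor (C D : category) := Functor {
  fob :> Ob C -> Ob D;
  fmor : Mor C -> Mor D;
  fdom : forall f, dom (fmor f) = fob (dom f);
  fcod : forall f, cod (fmor f) = fob (cod f);
  fidm : forall x, fmor (idm x) = idm (fob x);
  fcmp : forall g f (e : dom g = cod f) (e' : dom (fmor g) = cod (fmor f)),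
    fmor (cmp g f e) = cmp (fmor g) (fmor f) e'
}.

Definition feq (C D : category) (F G : functor C D) : Prop :=
  (forall x, F x = G x) /\ (forall f, fmor F f = fmor G f).

Definition idF (C : category) : functor C C.
Proof.
refine (@Functor C C (fun x => x) (fun f => f) _ _ _ _) => //.
by move=> g f e e'; exact: cmp_congr.
Defined.

Definition cmpF (C D E : category) (G : functor D E) (F : functor C D) :
  functor C E.
Proof.
refine (@Functor C E (fun x => G (F x)) (fun f => fmor G (fmor F f)) _ _ _ _).
- by move=> f; rewrite !fdom.
- by move=> f; rewrite !fcod.
- by move=> x; rewrite !fidm.
- move=> g f e e'.
  have e1 : dom (fmor F g) = cod (fmor F f) by rewrite fdom fcod e.
  by rewrite (fcmp e e1) (fcmp e1 e').
Defined.

Record nattrans (C D : category) (F G : functor C D) := Nattrans {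
  nt :> Ob C -> Mor D;
  nt_dom : forall x, dom (nt x) = F x;
  nt_cod : forall x, cod (nt x) = G x;
  nt_nat : forall f (e : dom (nt (cod f)) = cod (fmor F f))
    (e' : dom (fmor G f) = cod (nt (dom f))),
    cmp (nt (cod f)) (fmor F f) e = cmp (fmor G f) (nt (dom f)) e'
}.

Definition idN (C D : category) (F : functor C D) : nattrans F F.
Proof.
refine (@Nattrans C D F F (fun x => idm (F x)) _ _ _).
- by move=> x; rewrite dom_idm.
- by move=> x; rewrite cod_idm.
- move=> f e e'.
  have e1 : dom (idm (cod (fmor F f))) = cod (fmor F f) by rewrite dom_idm.
  have e2 : dom (fmor F f) = cod (idm (dom (fmor F f))) by rewrite cod_idm.
  transitivity (fmor F f).
    by rewrite -[RHS](cmp_idl e1); apply: cmp_congr; rewrite ?fcod.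
  by rewrite -[LHS](cmp_idr e2); apply: cmp_congr; rewrite ?fdom.
Defined.

(* Replaces the target functor by an equal one; the components are unchanged. *)
Definition convN (C D : category) (F G G' : functor C D) (e : feq G G')
  (a : nattrans F G) : nattrans F G'.
Proof.
refine (@Nattrans C D F G' a (nt_dom a) _ _).
- by move=> x; rewrite nt_cod; case: e.
- move=> f e1 e2; have e3 : dom (fmor G f) = cod (a (dom f)).
    by rewrite (proj2 e).
  by rewrite (nt_nat e1 e3); apply: cmp_congr => //; case: e.
Defined.

Lemma vcmp_def (C D : category) (F G H : functor C D) (b : nattrans G H)
  (a : nattrans F G) x : dom (b x) = cod (a x).
Proof. by rewrite nt_dom nt_cod. Qed.

Definition vcmp (C D : category) (F G H : functor C D) (b : nattrans G H)
  (a : nattrans F G) : nattrans F H.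
Proof.
refine (@Nattrans C D F H (fun x => cmp (b x) (a x) (vcmp_def b a x)) _ _ _).
- by move=> x; rewrite dom_cmp nt_dom.
- by move=> x; rewrite cod_cmp nt_cod.
- move=> f e e'.
  have e1 : dom (a (cod f)) = cod (fmor F f) by rewrite nt_dom fcod.
  have e2 : dom (b (cod f)) = cod (cmp _ _ e1) by rewrite nt_dom cod_cmp nt_cod.
  rewrite -(cmpA e2).
  have e3 : dom (fmor G f) = cod (a (dom f)) by rewrite fdom nt_cod.
  have e4 : dom (b (cod f)) = cod (cmp _ _ e3) by rewrite nt_dom cod_cmp fcod.
  have e5 : dom (b (cod f)) = cod (fmor G f) by rewrite nt_dom fcod.
  have e6 : dom (cmp _ _ e5) = cod (a (dom f)) by rewrite dom_cmp fdom nt_cod.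
  rewrite (@cmp_congr _ _ _ _ _ e2 e4 erefl (nt_nat e1 e3)) (cmpA e4 e6).
  have e7 : dom (fmor H f) = cod (b (dom f)) by rewrite fdom nt_cod.
  have e8 : dom (cmp _ _ e7) = cod (a (dom f)) by rewrite dom_cmp nt_dom nt_cod.
  by rewrite (cmpA e' e8); apply: cmp_congr => //; exact: nt_nat.
Defined.

Definition whiskl (C D E : category) (H : functor D E) (F G : functor C D)
  (a : nattrans F G) : nattrans (cmpF H F) (cmpF H G).
Proof.
refine (@Nattrans C E (cmpF H F) (cmpF H G) (fun x => fmor H (a x)) _ _ _).
- by move=> x; rewrite fdom nt_dom.
- by move=> x; rewrite fcod nt_cod.
- move=> f e e' /=.
  have e1 : dom (a (cod f)) = cod (fmor F f) by rewrite nt_dom fcod.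
  have e2 : dom (fmor G f) = cod (a (dom f)) by rewrite fdom nt_cod.
  by rewrite -(fcmp e1 e) -(fcmp e2 e') (nt_nat e1 e2).
Defined.

Definition whiskr (C D E : category) (F G : functor D E) (a : nattrans F G)
  (H : functor C D) : nattrans (cmpF F H) (cmpF G H).
Proof.
refine (@Nattrans C E (cmpF F H) (cmpF G H) (fun x => a (H x)) _ _ _).
- by move=> x; rewrite nt_dom.
- by move=> x; rewrite nt_cod.
- move=> f e e' /=.
  have e1 : dom (a (cod (fmor H f))) = cod (fmor F (fmor H f)).
    by rewrite nt_dom !fcod.
  have e2 : dom (fmor G (fmor H f)) = cod (a (dom (fmor H f))).
    by rewrite !fdom nt_cod.
  transitivity (cmp _ _ e1); first by apply: cmp_congr; rewrite ?fcod.
  by rewrite (nt_nat e1 e2); apply: cmp_congr; rewrite ?fdom.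
Defined.

Definition hcmp (C D E : category) (G G' : functor D E) (F F' : functor C D)
  (b : nattrans G G') (a : nattrans F F') : nattrans (cmpF G F) (cmpF G' F') :=
  vcmp (whiskr b F') (whiskl G a).

(* The category C^* of finite sequences (the disjoint union of the powers C^n). *)

Fixpoint scmp (C : category) (s t : seq (Mor C)) :
    map dom s = map cod t -> seq (Mor C) :=
  match s, t with
  | g :: s', f :: t' => fun e : dom g :: map dom s' = cod f :: map cod t' =>
      cmp g f (f_equal (head (dom g)) e) :: @scmp C s' t' (f_equal behead e)
  | _, _ => fun _ => [::]
  end.

Lemma scmp_congr (C : category) (s s' t t' : seq (Mor C)) e e' :
  s = s' -> t = t' -> @scmp C s t e = @scmp C s' t' e'.
Proof.
by move=> es et; subst s' t'; rewrite (proof_irrelevance _ e e').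
Qed.

Lemma scmp_map_def (C : category) (I : Type) (g f : I -> Mor C) (s : seq I) :
  (forall i, dom (g i) = cod (f i)) -> map dom (map g s) = map cod (map f s).
Proof. by move=> e; rewrite -!map_comp; apply: eq_map => i /=. Qed.

Lemma scmp_map (C : category) (I : Type) (g f : I -> Mor C)
    (e : forall i, dom (g i) = cod (f i)) (s : seq I) e' :
  @scmp C (map g s) (map f s) e' = [seq cmp (g i) (f i) (e i) | i <- s].
Proof.
elim: s e' => //= i s IHs e'; congr (_ :: _); last exact: IHs.
exact: cmp_congr.
Qed.

Definition star (C : category) : category.
Proof.
refine (@Category (seq (Ob C)) (seq (Mor C)) (map dom) (map cod) (map idm)
  (@scmp C) _ _ _ _ _ _ _).
- by move=> s; rewrite -map_comp -[RHS]map_id; apply: eq_map => x /=; rewrite dom_idm.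
- by move=> s; rewrite -map_comp -[RHS]map_id; apply: eq_map => x /=; rewrite cod_idm.
- elim=> [|g s IHs] [|f t] //= e; congr (_ :: _); first by rewrite dom_cmp.
  exact: IHs.
- elim=> [|g s IHs] [|f t] //= e; congr (_ :: _); first by rewrite cod_cmp.
  exact: IHs.
- elim=> [|f s IHs] //= e; congr (_ :: _); last exact: IHs.
  exact: cmp_idl.
- elim=> [|f s IHs] //= e; congr (_ :: _); last exact: IHs.
  exact: cmp_idr.
- elim=> [|h s IHs] [|g t] //= [|f u] //= e1 e2 e3 e4.
  congr (_ :: _); last exact: IHs.
  exact: cmpA.
Defined.

Definition starF (C D : category) (F : functor C D) : functor (star C) (star D).
Proof.
refine (@Functor (star C) (star D) (map F) (map (fmor F)) _ _ _ _).
- by move=> s /=; rewrite -!map_comp; apply: eq_map => f /=; rewrite fdom.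
- by move=> s /=; rewrite -!map_comp; apply: eq_map => f /=; rewrite fcod.
- by move=> s /=; rewrite -!map_comp; apply: eq_map => x /=; rewrite fidm.
- elim=> [|g s IHs] [|f t] //= e e'; congr (_ :: _); last exact: IHs.
  exact: fcmp.
Defined.

(* The ordered set {1 < ... < n} is represented by 'I_n = {0 < ... < n.-1}, and
   [n] = {0 < ... < n} by 'I_n.+1. *)

Record osk (m n : nat) := Osk {
  oskf :> 'I_m -> 'I_n;
  osk_homo : forall x y : 'I_m, x <= y -> oskf x <= oskf y
}.

Definition osk_id n : osk n n := @Osk n n id (fun _ _ e => e).

Definition osk_comp m n k (g : osk n k) (f : osk m n) : osk m k :=
  @Osk m k (fun x => g (f x)) (fun _ _ e => osk_homo g (osk_homo f e)).

Definition osk_to1 n : osk n 1 := @Osk n 1 (fun _ => ord0) (fun _ _ _ => leqnn 0).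

Definition pre m n (f : osk m n) (b : 'I_n) : {set 'I_m} := [set a | f a == b].

(* The preimage of b is identified with the ordinal 'I_(fib f b) by the
   increasing bijection emb f b. *)
Definition fib m n (f : osk m n) (b : 'I_n) : nat := #|pre f b|.

Definition emb m n (f : osk m n) (b : 'I_n) (i : 'I_(fib f b)) : 'I_m :=
  enum_val i.

Lemma embP m n (f : osk m n) b (i : 'I_(fib f b)) : f (emb i) = b.
Proof. by have := enum_valP i; rewrite inE => /eqP. Qed.

Lemma emb_inj m n (f : osk m n) b : injective (@emb m n f b).
Proof. exact: enum_val_inj. Qed.

Lemma sorted_enum_set n (A : {set 'I_n}) : sorted ltn (map val (enum A)).
Proof.
have -> : enum A = [seq x <- enum 'I_n | x \in A] by rewrite enumT.
apply: (@subseq_sorted _ ltn ltn_trans _ (map val (enum 'I_n))).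
  by apply: map_subseq; exact: filter_subseq.
by rewrite val_enum_ord iota_ltn_sorted.
Qed.

Lemma emb_lt m n (f : osk m n) b (i j : 'I_(fib f b)) : i < j -> emb i < emb j.
Proof.
move=> ij; pose x0 := emb i.
rewrite /emb !(enum_val_nth x0).
have si : forall k : 'I_(fib f b), k < size (enum (pre f b)).
  by move=> k; rewrite -cardE; exact: ltn_ord.
rewrite -!(nth_map x0 (val x0) val) //.
apply: (sorted_ltn_nth ltn_trans) => //.
- exact: sorted_enum_set.
- by rewrite inE size_map; exact: si.
- by rewrite inE size_map; exact: si.
Qed.

Lemma emb_le m n (f : osk m n) b (i j : 'I_(fib f b)) :
  (emb i <= emb j) = (i <= j).
Proof.
apply/idP/idP => [|ij].
  by apply: contraTT; rewrite -!ltnNge; exact: emb_lt.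
move: ij; rewrite leq_eqVlt => /orP[/eqP/val_inj -> //|/emb_lt/ltnW //].
Qed.

Lemma map_emb m n (f : osk m n) b :
  map (@emb m n f b) (enum 'I_(fib f b)) = enum (pre f b).
Proof.
case E: (enum (pre f b)) => [|a0 s].
  have E0 : fib f b = 0 by rewrite /fib cardE E.
  by apply/nilP; rewrite /nilp size_map size_enum_ord E0.
rewrite -E; apply: (@eq_from_nth _ a0).
  by rewrite size_map size_enum_ord /fib cardE.
move=> i; rewrite size_map size_enum_ord => ib.
have i0 : 'I_(fib f b) by exists i.
rewrite (nth_map i0) ?size_enum_ord // /emb (enum_val_nth a0).
by rewrite nth_enum_ord.
Qed.

Lemma emb_onto m n (f : osk m n) b a : f a = b -> {i : 'I_(fib f b) | emb i = a}.
Proof.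
move=> fa; have ab : a \in pre f b by rewrite inE fa.
by exists (enum_rank_in ab a); exact: enum_rankK_in.
Defined.

(* The restriction of u to the preimages of c under w = v \o u and under v. *)
Lemma restr_def m n k (u : osk m n) (v : osk n k) (w : osk m k)
  (e : forall x, w x = v (u x)) (c : 'I_k) (i : 'I_(fib w c)) : v (u (emb i)) = c.
Proof. by rewrite -e embP. Qed.

Definition restr m n k (u : osk m n) (v : osk n k) (w : osk m k)
  (e : forall x, w x = v (u x)) (c : 'I_k) : osk (fib w c) (fib v c).
Proof.
refine (@Osk _ _ (fun i => sval (emb_onto (restr_def e i))) _).
move=> i j ij; rewrite -emb_le.
case: (emb_onto (restr_def e i)) => i' /= ->.
case: (emb_onto (restr_def e j)) => j' /= ->.
by apply: osk_homo; rewrite emb_le.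
Defined.

Lemma emb_restr m n k (u : osk m n) (v : osk n k) (w : osk m k)
    (e : forall x, w x = v (u x)) (c : 'I_k) (i : 'I_(fib w c)) :
  emb (restr e c i) = u (emb i).
Proof. by rewrite /restr /=; case: (emb_onto _). Qed.

Lemma pre_restr m n k (u : osk m n) (v : osk n k) (w : osk m k)
    (e : forall x, w x = v (u x)) (c : 'I_k) (b : 'I_(fib v c)) :
  map (@emb _ _ w c) (enum (pre (restr e c) b)) = enum (pre u (emb b)).
Proof.
have enumF : forall p (A : {set 'I_p}),
    enum A = [seq x <- enum 'I_p | x \in A].
  by move=> p A; rewrite enumT.
rewrite [in LHS]enumF.
have -> : [seq x <- enum 'I_(fib w c) | x \in pre (restr e c) b]
    = [seq x <- enum 'I_(fib w c) | (emb x) \in pre u (emb b)].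
  by apply: eq_filter => x; rewrite !inE -(inj_eq (@emb_inj _ _ v c)) emb_restr.
rewrite -(filter_map (@emb _ _ w c) (fun x => x \in pre u (emb b))) map_emb.
rewrite enumF [RHS]enumF -filter_predI; apply: eq_filter => x /=.
rewrite !inE andb_idr // => /eqP ux.
by rewrite e ux embP.
Qed.

(* psi = [f] : [J] -> [I], y |-> max ({0} u {x in I | f x <= y}); the 1-based
   elements x and f x are x.+1 and (f x).+1 here. *)
Definition psi_val n m (f : osk n m) (y : nat) : nat := \max_(x < n | f x < y) x.+1.

Lemma psi_le n m (f : osk n m) y : psi_val f y < n.+1.
Proof. by rewrite ltnS; apply/bigmax_leqP => x _; exact: ltn_ord. Qed.

Definition psi n m (f : osk n m) (y : 'I_m.+1) : 'I_n.+1 := Ordinal (psi_le f y).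

Lemma psi_homo n m (f : osk n m) (y z : 'I_m.+1) : y <= z -> psi f y <= psi f z.
Proof.
move=> yz; rewrite /= /psi_val; apply/bigmax_leqP => x fx.
by apply: (bigmax_sup x) => //; exact: leq_trans fx yz.
Qed.

Lemma psi_card n m (f : osk n m) y : psi_val f y = #|[set x | f x < y]|.
Proof.
have down : forall x z : 'I_n, x <= z -> f z < y -> f x < y.
  by move=> x z xz; apply: leq_ltn_trans; exact: osk_homo.
have E : [set x : 'I_n | f x < y] = [set x : 'I_n | x < psi_val f y].
  apply/setP => x; rewrite !inE; apply/idP/idP => [fx|].
    by rewrite /psi_val; apply: (bigmax_sup x).
  rewrite ltnNge; apply: contraR; rewrite -leqNgt => fx.
  apply/bigmax_leqP => z fz; rewrite ltnNge; apply/negP => xz.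
  by have := down _ _ xz fz; rewrite ltnNge fx.
rewrite E cardsE cardE size_filter -(count_map val (fun i => i < psi_val f y)).
have := psi_le f y; rewrite ltnS; move: (psi_val f y) => k kn.
rewrite -enumT val_enum_ord -size_filter.
have -> : [seq i <- iota 0 n | i < k] = iota 0 k.
  rewrite -(subnKC kn) iotaD filter_cat.
  rewrite (@eq_in_filter _ _ predT); last by move=> i; rewrite mem_iota.
  rewrite filter_predT (@eq_in_filter _ _ pred0) ?filter_pred0 ?cats0 //.
  by move=> i; rewrite mem_iota add0n => /andP[ki _]; rewrite ltnNge ki.
by rewrite size_iota.
Qed.

Lemma psi0 n m (f : osk n m) : psi f ord0 = ord0.
Proof. by apply: val_inj; rewrite /= /psi_val big_pred0. Qed.

Lemma psi_max n m (f : osk n m) : psi f ord_max = ord_max.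
Proof.
apply: val_inj; rewrite /= psi_card -[RHS]card_ord; apply: eq_card => x.
by rewrite !inE ltn_ord.
Qed.

(* Levels h - 1 and h of a tree, for h in I. *)
Definition lo n (h : 'I_n) : 'I_n.+1 := widen_ord (leqnSn n) h.
Definition hi n (h : 'I_n) : 'I_n.+1 := lift ord0 h.

Lemma lohi n (h : 'I_n) : lo h <= hi h.
Proof. by rewrite /= /bump add1n. Qed.

Lemma psi_fib n m (f : osk n m) (g : 'I_m) :
  psi f (lo g) + fib f g = psi f (hi g).
Proof.
rewrite /= !psi_card /bump add1n /fib -cardsUI.
have -> : [set x | f x < g] :&: pre f g = set0.
  by apply/setP => x; rewrite !inE -val_eqE /=; case: ltngtP.
rewrite cards0 addn0; apply: eq_card => x.
by rewrite !inE [RHS]ltnS [RHS]leq_eqVlt -val_eqE orbC.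
Qed.

(* Trees: functors [n] -> O_sk sending the top to 1. *)
Record tree (n : nat) := Tree {
  lev : 'I_n.+1 -> nat;
  tmap : forall i j : 'I_n.+1, i <= j -> osk (lev i) (lev j);
  tmap_id : forall (i : 'I_n.+1) (e : i <= i) x, tmap e x = x;
  tmap_comp : forall (i j k : 'I_n.+1) (e1 : i <= j) (e2 : j <= k) (e3 : i <= k) x,
    tmap e3 x = tmap e2 (tmap e1 x);
  lev_top : lev ord_max = 1
}.

Definition tree_top n (t : tree n) : 'I_(lev t ord_max) :=
  cast_ord (esym (lev_top t)) ord0.

Lemma top_uniq n (t : tree n) (b : 'I_(lev t ord_max)) : b = tree_top t.
Proof.
apply: val_inj => /=; have := ltn_ord b; rewrite [X in _ < X]lev_top.
by case: (val b).
Qed.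

Definition tree_psi n m (f : osk n m) (t : tree n) : tree m.
Proof.
refine (@Tree m (fun y => lev t (psi f y))
  (fun i j e => tmap t (psi_homo f e)) _ _ _).
- by move=> *; exact: tmap_id.
- by move=> *; exact: tmap_comp.
- by rewrite psi_max lev_top.
Defined.

(* Level k of a tree over the preimage of g is level psi (g - 1) + k of t. *)
Lemma shift_lt n m (f : osk n m) (g : 'I_m) (k : 'I_(fib f g).+1) :
  psi f (lo g) + k < n.+1.
Proof.
apply: leq_ltn_trans (ltn_ord (psi f (hi g))).
by rewrite -psi_fib leq_add2l -ltnS.
Qed.

Definition shift n m (f : osk n m) (g : 'I_m) (k : 'I_(fib f g).+1) : 'I_n.+1 :=
  Ordinal (shift_lt k).

Lemma shift_homo n m (f : osk n m) (g : 'I_m) (i j : 'I_(fib f g).+1) :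
  i <= j -> shift i <= shift j.
Proof. by move=> ij; rewrite /= leq_add2l. Qed.

Lemma shift_le n m (f : osk n m) (g : 'I_m) (k : 'I_(fib f g).+1) :
  shift k <= psi f (hi g).
Proof. by rewrite -psi_fib /= leq_add2l -ltnS. Qed.

Lemma shift_max n m (f : osk n m) (g : 'I_m) :
  shift (ord_max : 'I_(fib f g).+1) = psi f (hi g).
Proof. by apply: val_inj; exact: psi_fib. Qed.

Lemma shift0 n m (f : osk n m) (g : 'I_m) :
  shift (ord0 : 'I_(fib f g).+1) = psi f (lo g).
Proof. by apply: val_inj; rewrite /= addn0. Qed.

Lemma shiftI_lt n m (f : osk n m) (g : 'I_m) (k : 'I_(fib f g)) :
  psi f (lo g) + k < n.
Proof.
rewrite -ltnS; apply: leq_trans (ltn_ord (psi f (hi g))).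
by rewrite -psi_fib ltnS -addnS leq_add2l.
Qed.

Definition shiftI n m (f : osk n m) (g : 'I_m) (k : 'I_(fib f g)) : 'I_n :=
  Ordinal (shiftI_lt k).

Lemma shift_lo n m (f : osk n m) (g : 'I_m) (k : 'I_(fib f g)) :
  shift (lo k) = lo (shiftI k).
Proof. exact: val_inj. Qed.

Lemma shift_hi n m (f : osk n m) (g : 'I_m) (k : 'I_(fib f g)) :
  shift (hi k) = hi (shiftI k).
Proof. by apply: val_inj; rewrite /= /bump !add1n addnS. Qed.

(* The map from level psi (g - 1) + k to level psi g. *)
Definition to_root n m (f : osk n m) (t : tree n) (g : 'I_m)
  (k : 'I_(fib f g).+1) : osk (lev t (shift k)) (lev t (psi f (hi g))) :=
  tmap t (shift_le k).

Lemma to_rootE n m (f : osk n m) (t : tree n) (g : 'I_m) (i j : 'I_(fib f g).+1)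
  (e : i <= j) x : to_root t i x = to_root t j (tmap t (shift_homo e) x).
Proof. exact: tmap_comp. Qed.

Lemma fib_id n (u : osk n n) b : (forall x, u x = x) -> fib u b = 1.
Proof.
move=> uid; rewrite /fib -(cards1 b); apply: eq_card => x.
by rewrite !inE uid.
Qed.

(* If i = j then tmap i j is the cast. *)
Lemma tmap_cast n (t : tree n) (i j : 'I_n.+1) (e : i <= j) (ij : i = j) x :
  tmap t e x = cast_ord (congr1 (lev t) ij) x.
Proof. by move: e x; case: _ / ij => e x; rewrite tmap_id cast_ord_id. Qed.

Definition tree_fib n m (f : osk n m) (t : tree n) (g : 'I_m)
  (c : 'I_(lev t (psi f (hi g)))) : tree (fib f g).
Proof.
refine (@Tree (fib f g) (fun k => fib (to_root t k) c)
  (fun i j e => restr (@to_rootE n m f t g i j e) c) _ _ _).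
- by move=> i e x; apply: emb_inj; rewrite emb_restr tmap_id.
- move=> i j k e1 e2 e3 x; apply: emb_inj; rewrite !emb_restr.
  exact: tmap_comp.
- rewrite /to_root; move: (shift_le _) => e0.
  transitivity #|pred1 (cast_ord (congr1 (lev t) (esym (shift_max f g))) c)|.
    apply: eq_card => x; rewrite !inE (tmap_cast e0 (shift_max f g)).
    rewrite -!val_eqE /=; done.
  exact: card1.
Defined.

(* A multiquiver on the level of sets; a multiquiver of categories has one
   of objects and one of morphisms, and boxdot is formed for either by the same
   formula. *)
Record span (A : Type) := Span {
  scar :> Type;
  ssrc : scar -> seq A;
  stgt : scar -> A
}.

Definition span_map (A B : Type) (u : A -> B) (X : span A) (Y : span B)
    (v : X -> Y) : Prop :=
  (forall x, ssrc (v x) = map u (ssrc x)) /\ (forall x, stgt (v x) = u (stgt x)).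

Record box (A : Type) (n : nat) (X : 'I_n -> span A) := Box {
  bt : tree n;
  bl : forall h : 'I_n.+1, 'I_(lev bt h) -> A;
  bp : forall h : 'I_n, 'I_(lev bt (hi h)) -> X h;
  bp_tgt : forall (h : 'I_n) b, stgt (@bp h b) = @bl (hi h) b;
  bp_src : forall (h : 'I_n) b, ssrc (@bp h b)
    = [seq @bl (lo h) a | a <- enum (pre (tmap bt (lohi h)) b)]
}.
Arguments bl {A n X} _ h _.
Arguments bp {A n X} _ h _.

Definition box_src A n (X : 'I_n -> span A) (x : box X) : seq A :=
  [seq bl x ord0 a | a <- enum 'I_(lev (bt x) ord0)].

Definition box_tgt A n (X : 'I_n -> span A) (x : box X) : A :=
  bl x ord_max (tree_top (bt x)).

Definition boxS A n (X : 'I_n -> span A) : span A :=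
  Span (@box_src A n X) (@box_tgt A n X).

Lemma Box_eq A n (X : 'I_n -> span A) t l l' p p' H1 H2 H1' H2' :
  (forall h b, l h b = l' h b) -> (forall h b, p h b = p' h b) ->
  @Box A n X t l p H1 H2 = @Box A n X t l' p' H1' H2'.
Proof.
move=> el ep.
have E : l = l'.
  by apply: functional_extensionality_dep => h; apply: functional_extensionality.
have E' : p = p'.
  by apply: functional_extensionality_dep => h; apply: functional_extensionality.
subst l' p'; congr Box; exact: proof_irrelevance.
Qed.

Definition box_map A B (u : A -> B) n (X : 'I_n -> span A) (Y : 'I_n -> span B)
  (v : forall h, X h -> Y h) (H : forall h, span_map u (@v h)) (x : box X) : box Y.
Proof.
refine (@Box B n Y (bt x) (fun h b => u (bl x h b)) (fun h b => v h (bp x h b)) _ _).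
- by move=> h b; rewrite (proj2 (H h)) bp_tgt.
- by move=> h b; rewrite (proj1 (H h)) bp_src -map_comp.
Defined.

Lemma box_map_span A B (u : A -> B) n (X : 'I_n -> span A) (Y : 'I_n -> span B)
    (v : forall h, X h -> Y h) (H : forall h, span_map u (@v h)) :
  @span_map A B u (boxS X) (boxS Y) (box_map H).
Proof. by split=> x //=; rewrite /box_src -map_comp. Qed.

(* The regrouping Lambda^f : the tree becomes t_psi, and the label of (g, c) is the
   tree of preimages of c at the levels psi (g - 1), ..., psi g of t. *)

Section Regroup.
Variables (A : Type) (X : span A) (n m : nat) (f : osk n m).
Variable x : box (fun _ : 'I_n => X).

Let t := bt x.

Lemma src_cast (i j i' j' : 'I_n.+1) (ei : i' = i) (ej : j' = j) (l : i <= j)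
    (l' : i' <= j') (b : 'I_(lev t j')) :
  [seq bl x i a | a <- enum (pre (tmap t l) (cast_ord (congr1 (lev t) ej) b))]
  = [seq bl x i' a | a <- enum (pre (tmap t l') b)].
Proof.
subst i' j'; rewrite cast_ord_id; congr map; congr enum_mem; congr mem.
by rewrite (bool_irrelevance l l').
Qed.

Lemma bl_cast (i j : 'I_n.+1) (e : i = j) (b : 'I_(lev t i)) :
  bl x j (cast_ord (congr1 (lev t) e) b) = bl x i b.
Proof. by subst j; rewrite cast_ord_id. Qed.

Definition regroup_fib (g : 'I_m) (c : 'I_(lev t (psi f (hi g)))) :
  box (fun _ : 'I_(fib f g) => X).
Proof.
refine (@Box A (fib f g) (fun _ => X) (tree_fib c)
  (fun k b => bl x (shift k) (emb b))
  (fun k b => bp x (shiftI k) (cast_ord (congr1 (lev t) (shift_hi k)) (emb b)))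
  _ _).
- by move=> k b; rewrite bp_tgt bl_cast.
- move=> k b; rewrite bp_src.
  have l : shift (lo k) <= shift (hi k) by apply: shift_homo; exact: lohi.
  rewrite (src_cast (shift_lo k) (shift_hi k) _ l (emb b)).
  have -> : l = shift_homo (lohi k) by exact: bool_irrelevance.
  by rewrite -(pre_restr (@to_rootE n m f t g _ _ (lohi k))) -map_comp.
Defined.

Definition regroup :
  box (fun g : 'I_m => boxS (fun _ : 'I_(fib f g) => X)).
Proof.
refine (@Box A m (fun g => boxS (fun _ : 'I_(fib f g) => X)) (tree_psi f t)
  (fun h b => bl x (psi f h) b) (fun g c => @regroup_fib g c) _ _).
- move=> g c /=; rewrite /box_tgt /=.
  set b := tree_top _.
  have := embP b; move: (emb b) => a; rewrite /to_root (tmap_cast _ (shift_max f g)).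
  by move=> <-; rewrite bl_cast.
- move=> g c; rewrite /= /box_src /=.
  have := src_cast (shift0 f g) erefl (psi_homo f (lohi g)) (shift_le ord0) c.
  rewrite cast_ord_id => ->.
  by rewrite -[in RHS](map_emb (to_root t (ord0 : 'I_(fib f g).+1)) c) -[RHS]map_comp.
Defined.

End Regroup.

Record mquiver (C : category) := Mquiver {
  mq :> category;
  msrc : functor mq (star C);
  mtgt : functor mq C
}.

Definition obS (C : category) (X : mquiver C) : span (Ob C) :=
  @Span (Ob C) (Ob X) (fob (msrc X)) (fob (mtgt X)).

Definition morS (C : category) (X : mquiver C) : span (Mor C) :=
  @Span (Mor C) (Mor X) (fmor (msrc X)) (fmor (mtgt X)).

Lemma dom_span (C : category) (X : mquiver C) :
  @span_map _ _ dom (morS X) (obS X) dom.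
Proof. by split=> f /=; rewrite -fdom. Qed.

Lemma cod_span (C : category) (X : mquiver C) :
  @span_map _ _ cod (morS X) (obS X) cod.
Proof. by split=> f /=; rewrite -fcod. Qed.

Lemma idm_span (C : category) (X : mquiver C) :
  @span_map _ _ idm (obS X) (morS X) idm.
Proof. by split=> f /=; rewrite fidm. Qed.

Definition lcast n (t t' : tree n) (e : t = t') h (b : 'I_(lev t h)) : 'I_(lev t' h) :=
  cast_ord (congr1 (fun t => lev t h) e) b.

Lemma val_lcast n (t t' : tree n) (e : t = t') h b : val (@lcast n t t' e h b) = val b.
Proof. by []. Qed.

Lemma lcast_id n (t : tree n) (e : t = t) h (b : 'I_(lev t h)) : lcast e b = b.
Proof. exact: val_inj. Qed.

Lemma Box_eqT A n (X : 'I_n -> span A) (x y : box X) (e : bt x = bt y) :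
  (forall h b, bl x h b = bl y h (lcast e b)) ->
  (forall h b, bp x h b = bp y h (lcast e b)) -> x = y.
Proof.
case: x e => t l p H1 H2; case: y => t' l' p' H1' H2' /= e.
subst t' => el ep.
by apply: Box_eq => h b; rewrite ?el ?ep lcast_id.
Qed.

Ltac box_ext := unshelve eapply Box_eqT; [reflexivity | | ].

Lemma bl_val A n (X : 'I_n -> span A) (x y : box X) (e : x = y) h b b' :
  val b = val b' -> bl x h b = bl y h b'.
Proof. by subst y => /val_inj ->. Qed.

Lemma bp_val A n (X : 'I_n -> span A) (x y : box X) (e : x = y) h b b' :
  val b = val b' -> bp x h b = bp y h b'.
Proof. by subst y => /val_inj ->. Qed.

Section BoxCategory.
Variables (C : category) (n : nat) (X : 'I_n -> mquiver C).

Let OB := box (fun h => obS (X h)).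
Let MOR := box (fun h => morS (X h)).

Definition box_dom : MOR -> OB := box_map (fun h => dom_span (X h)).
Definition box_cod : MOR -> OB := box_map (fun h => cod_span (X h)).
Definition box_idm : OB -> MOR := box_map (fun h => idm_span (X h)).

Lemma box_cmp_tree (y x : MOR) (e : box_dom y = box_cod x) : bt x = bt y.
Proof. exact: (esym (congr1 (@bt _ _ _) e)). Qed.

Lemma box_cmp_l (y x : MOR) (e : box_dom y = box_cod x) h b :
  dom (bl y h (lcast (box_cmp_tree e) b)) = cod (bl x h b).
Proof. exact: (bl_val e). Qed.

Lemma box_cmp_p (y x : MOR) (e : box_dom y = box_cod x) h b :
  dom (bp y h (lcast (box_cmp_tree e) b)) = cod (bp x h b).
Proof. exact: (bp_val e). Qed.

Lemma map_pre_lcast (A : Type) (t t' : tree n) (e : t = t') (h : 'I_n)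
    (l : 'I_(lev t' (lo h)) -> A) b :
  [seq l a | a <- enum (pre (tmap t' (lohi h)) (lcast e b))]
  = [seq l (lcast e a) | a <- enum (pre (tmap t (lohi h)) b)].
Proof.
by subst t'; rewrite lcast_id; apply: eq_map => a; rewrite lcast_id.
Qed.

Lemma map_lev_lcast (A : Type) (t t' : tree n) (e : t = t') h
    (l : 'I_(lev t' h) -> A) :
  [seq l a | a <- enum 'I_(lev t' h)] = [seq l (lcast e a) | a <- enum 'I_(lev t h)].
Proof. by subst t'; apply: eq_map => a; rewrite lcast_id. Qed.

Definition box_cmp (y x : MOR) (e : box_dom y = box_cod x) : MOR.
Proof.
refine (@Box _ n (fun h => morS (X h)) (bt x)
  (fun h b => cmp (bl y h (lcast (box_cmp_tree e) b)) (bl x h b) (box_cmp_l e b))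
  (fun h b => cmp (bp y h (lcast (box_cmp_tree e) b)) (bp x h b) (box_cmp_p e b))
  _ _).
- move=> h b /=.
  have e1 : dom (fmor (mtgt (X h)) (bp y h (lcast (box_cmp_tree e) b)))
      = cod (fmor (mtgt (X h)) (bp x h b)) by rewrite fdom fcod box_cmp_p.
  rewrite (fcmp _ e1); apply: cmp_congr; first exact: (bp_tgt (lcast _ b)).
  exact: bp_tgt.
- move=> h b /=.
  have e1 : dom (fmor (msrc (X h)) (bp y h (lcast (box_cmp_tree e) b)))
      = cod (fmor (msrc (X h)) (bp x h b)) by rewrite fdom fcod box_cmp_p.
  rewrite (fcmp _ e1) /=.
  rewrite -(scmp_map _ (scmp_map_def _ (fun a => box_cmp_l e a))).
  apply: scmp_congr; last exact: (bp_src b).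
  by rewrite -map_pre_lcast; exact: (bp_src (lcast (box_cmp_tree e) b)).
Defined.


Definition box_category : category.
Proof.
refine (@Category OB MOR box_dom box_cod box_idm box_cmp _ _ _ _ _ _ _).
- move=> x; box_ext => h b /=;
    by rewrite lcast_id dom_idm.
- move=> x; box_ext => h b /=;
    by rewrite lcast_id cod_idm.
- move=> y x e; box_ext => h b /=;
    by rewrite lcast_id dom_cmp.
- move=> y x e; (unshelve eapply Box_eqT; [exact (box_cmp_tree e) | | ]) => h b /=;
    by rewrite cod_cmp.
- move=> f e; box_ext => h b /=; rewrite [in RHS]lcast_id.
    have e1 : dom (idm (cod (bl f h b))) = cod (bl f h b) by rewrite dom_idm.
    rewrite -[RHS](cmp_idl e1); apply: cmp_congr => //=.
    by congr (idm (cod (bl f h _))); exact: val_inj.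
  have e1 : dom (idm (cod (bp f h b))) = cod (bp f h b) by rewrite dom_idm.
  rewrite -[RHS](cmp_idl e1); apply: cmp_congr => //=.
  by congr (idm (cod (bp f h _))); exact: val_inj.
- move=> f e; box_ext => h b /=; rewrite [in RHS]lcast_id.
    have e1 : dom (bl f h b) = cod (idm (dom (bl f h b))) by rewrite cod_idm.
    rewrite -[RHS](cmp_idr e1); apply: cmp_congr => //=.
    by congr (bl f h _); exact: val_inj.
  have e1 : dom (bp f h b) = cod (idm (dom (bp f h b))) by rewrite cod_idm.
  rewrite -[RHS](cmp_idr e1); apply: cmp_congr => //=.
  by congr (bp f h _); exact: val_inj.
- move=> k g f e1 e2 e3 e4; box_ext => h b.
    rewrite [in RHS]lcast_id /=.
    have E3 : dom (bl k h (lcast (box_cmp_tree e2) b))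
        = cod (bl g h (lcast (box_cmp_tree e1) b)).
      rewrite -(box_cmp_l e3); congr (dom (bl k h _)); exact: val_inj.
    have E4 : dom (cmp _ _ E3) = cod (bl f h b) by rewrite dom_cmp box_cmp_l.
    rewrite (cmpA _ E4); apply: cmp_congr => //; apply: cmp_congr.
      by congr (bl k h _); exact: val_inj.
    by congr (bl g h _); exact: val_inj.
  rewrite [in RHS]lcast_id /=.
  have E3 : dom (bp k h (lcast (box_cmp_tree e2) b))
      = cod (bp g h (lcast (box_cmp_tree e1) b)).
    rewrite -(box_cmp_p e3); congr (dom (bp k h _)); exact: val_inj.
  have E4 : dom (cmp _ _ E3) = cod (bp f h b) by rewrite dom_cmp box_cmp_p.
  rewrite (cmpA _ E4); apply: cmp_congr => //; apply: cmp_congr.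
    by congr (bp k h _); exact: val_inj.
  by congr (bp g h _); exact: val_inj.
Defined.

Definition box_srcF : functor box_category (star C).
Proof.
refine (@Functor box_category (star C) (@box_src _ _ (fun h => obS (X h)))
  (@box_src _ _ (fun h => morS (X h))) _ _ _ _).
- exact: (fun f => esym (proj1 (box_map_span (fun h => dom_span (X h))) f)).
- exact: (fun f => esym (proj1 (box_map_span (fun h => cod_span (X h))) f)).
- exact: (fun x => proj1 (box_map_span (fun h => idm_span (X h))) x).
- move=> g f e e' /=; rewrite /box_src /=.
  rewrite -(scmp_map _ (scmp_map_def _ (fun a => box_cmp_l e a))).
  apply: scmp_congr => //.
  by rewrite -map_lev_lcast.
Defined.

Definition box_tgtF : functor box_category C.
Proof.
refine (@Functor box_category C (@box_tgt _ _ (fun h => obS (X h)))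
  (@box_tgt _ _ (fun h => morS (X h))) _ _ _ _).
- exact: (fun f => esym (proj2 (box_map_span (fun h => dom_span (X h))) f)).
- exact: (fun f => esym (proj2 (box_map_span (fun h => cod_span (X h))) f)).
- exact: (fun x => proj2 (box_map_span (fun h => idm_span (X h))) x).
- move=> g f e e' /=; rewrite /box_tgt /=.
  apply: cmp_congr => //.
  by congr (bl g ord_max _); exact: top_uniq.
Defined.

(* boxdot^{h in I} X_h *)
Definition boxQ : mquiver C := @Mquiver C box_category box_srcF box_tgtF.

End BoxCategory.

Notation boxC n X := (boxQ (fun _ : 'I_n => X)).

(* Functors between multiquivers over u, and transformations over tau.  Functors
   commuting with src and tgt are those over idF; transformations mapped to
   identities by src and tgt are those over the identity transformation. *)

Record mqfun (C D : category) (u : functor C D) (X : mquiver C) (Y : mquiver D) :=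
  Mqfun {
  mqf :> functor X Y;
  mqf_src : feq (cmpF (msrc Y) mqf) (cmpF (starF u) (msrc X));
  mqf_tgt : feq (cmpF (mtgt Y) mqf) (cmpF u (mtgt X))
}.

Record mqnat (C D : category) (u v : functor C D) (tau : nattrans u v)
    (X : mquiver C) (Y : mquiver D) (F : mqfun u X Y) (G : mqfun v X Y) := Mqnat {
  mqn :> nattrans F G;
  mqn_src : forall x, fmor (msrc Y) (mqn x) = map tau (msrc X x);
  mqn_tgt : forall x, fmor (mtgt Y) (mqn x) = tau (mtgt X x)
}.

Definition mqcmp_gen (C D E : category) (v : functor D E) (u : functor C D)
  (w : functor C E) (e : feq (cmpF v u) w)
  (X : mquiver C) (Y : mquiver D) (Z : mquiver E)
  (G : mqfun v Y Z) (F : mqfun u X Y) : mqfun w X Z.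
Proof.
refine (@Mqfun _ _ w X Z (cmpF G F) _ _); case: (e) => eo em.
- case: (mqf_src G) (mqf_src F) => [a1 a2] [b1 b2]; split=> x /=.
    by rewrite [LHS]a1 /= [fob _ _]b1 /= -map_comp; exact: eq_map.
  by rewrite [LHS]a2 /= [fmor _ _]b2 /= -map_comp; exact: eq_map.
- case: (mqf_tgt G) (mqf_tgt F) => [a1 a2] [b1 b2]; split=> x /=.
    by rewrite [LHS]a1 -eo /=; congr (v _); exact: b1.
  by rewrite [LHS]a2 -em /=; congr (fmor v _); exact: b2.
Defined.

Lemma feq_idl (C D : category) (u : functor C D) : feq (cmpF (idF D) u) u.
Proof. by []. Qed.

Lemma feq_idr (C D : category) (u : functor C D) : feq (cmpF u (idF C)) u.
Proof. by []. Qed.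

(* Composites G \o F over u, where G, resp. F, commutes with src and tgt. *)

Definition mqcmpl (C D : category) (u : functor C D) (X : mquiver C)
    (Y Z : mquiver D) (G : mqfun (idF D) Y Z) (F : mqfun u X Y) : mqfun u X Z :=
  mqcmp_gen (feq_idl u) G F.

Definition mqcmpr (C D : category) (u : functor C D) (X Y : mquiver C)
    (Z : mquiver D) (G : mqfun u Y Z) (F : mqfun (idF C) X Y) : mqfun u X Z :=
  mqcmp_gen (feq_idr u) G F.

Lemma mqf_ob_span (C D : category) (u : functor C D) (X : mquiver C)
    (Y : mquiver D) (F : mqfun u X Y) : @span_map _ _ u (obS X) (obS Y) F.
Proof. by split=> x; [exact: (proj1 (mqf_src F))|exact: (proj1 (mqf_tgt F))]. Qed.

Lemma mqf_mor_span (C D : category) (u : functor C D) (X : mquiver C)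
    (Y : mquiver D) (F : mqfun u X Y) :
  @span_map _ _ (fmor u) (morS X) (morS Y) (fmor F).
Proof. by split=> x; [exact: (proj2 (mqf_src F))|exact: (proj2 (mqf_tgt F))]. Qed.

Lemma mqn_span (C D : category) (u v : functor C D) (tau : nattrans u v)
    (X : mquiver C) (Y : mquiver D) (F : mqfun u X Y) (G : mqfun v X Y)
    (a : mqnat tau F G) : @span_map _ _ tau (obS X) (morS Y) a.
Proof. by split=> x; [exact: mqn_src|exact: mqn_tgt]. Qed.

Definition boxF_functor (C D : category) (u : functor C D) n
  (X : 'I_n -> mquiver C) (Y : 'I_n -> mquiver D)
  (F : forall h, mqfun u (X h) (Y h)) : functor (boxQ X) (boxQ Y).
Proof.
refine (@Functor (boxQ X) (boxQ Y) (box_map (fun h => mqf_ob_span (F h)))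
  (box_map (fun h => mqf_mor_span (F h))) _ _ _ _).
- by move=> f; apply: Box_eq => h b /=; rewrite fdom.
- by move=> f; apply: Box_eq => h b /=; rewrite fcod.
- by move=> x; apply: Box_eq => h b /=; rewrite fidm.
- move=> g f e e'; apply: Box_eq => h b /=.
    have e1 : dom (fmor u (bl g h (lcast (box_cmp_tree e) b)))
        = cod (fmor u (bl f h b)) by rewrite fdom fcod box_cmp_l.
    rewrite (fcmp _ e1); apply: cmp_congr => //.
    by congr (fmor _ (bl g h _)); exact: val_inj.
  have e1 : dom (fmor (F h) (bp g h (lcast (box_cmp_tree e) b)))
      = cod (fmor (F h) (bp f h b)) by rewrite fdom fcod box_cmp_p.
  rewrite (fcmp _ e1); apply: cmp_congr => //.
  by congr (fmor _ (bp g h _)); exact: val_inj.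
Defined.

Definition boxF (C D : category) (u : functor C D) n (X : 'I_n -> mquiver C)
  (Y : 'I_n -> mquiver D) (F : forall h, mqfun u (X h) (Y h)) :
  mqfun u (boxQ X) (boxQ Y).
Proof.
refine (@Mqfun _ _ u (boxQ X) (boxQ Y) (boxF_functor F) _ _).
- split; first exact: (proj1 (box_map_span (fun h => mqf_ob_span (F h)))).
  exact: (proj1 (box_map_span (fun h => mqf_mor_span (F h)))).
- split; first exact: (proj2 (box_map_span (fun h => mqf_ob_span (F h)))).
  exact: (proj2 (box_map_span (fun h => mqf_mor_span (F h)))).
Defined.

Definition boxN_nattrans (C D : category) (u v : functor C D)
  (tau : nattrans u v) n (X : 'I_n -> mquiver C) (Y : 'I_n -> mquiver D)
  (F : forall h, mqfun u (X h) (Y h)) (G : forall h, mqfun v (X h) (Y h))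
  (a : forall h, mqnat tau (F h) (G h)) : nattrans (boxF F) (boxF G).
Proof.
refine (@Nattrans (boxQ X) (boxQ Y) (boxF F) (boxF G)
  (box_map (fun h => mqn_span (a h))) _ _ _).
- by move=> x; apply: Box_eq => h b /=; rewrite nt_dom.
- by move=> x; apply: Box_eq => h b /=; rewrite nt_cod.
- move=> f e e'; apply: Box_eq => h b /=.
    have e1 : dom (tau (cod (bl f h b))) = cod (fmor u (bl f h b)).
      by rewrite nt_dom fcod.
    have e2 : dom (fmor v (bl f h b)) = cod (tau (dom (bl f h b))).
      by rewrite nt_cod fdom.
    transitivity (cmp _ _ e1).
      by apply: cmp_congr => //; congr (tau (cod (bl f h _))); exact: val_inj.
    rewrite (nt_nat e1 e2); apply: cmp_congr => //.
    by congr (fmor _ (bl f h _)); exact: val_inj.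
  have e1 : dom (a h (cod (bp f h b))) = cod (fmor (F h) (bp f h b)).
    by rewrite nt_dom fcod.
  have e2 : dom (fmor (G h) (bp f h b)) = cod (a h (dom (bp f h b))).
    by rewrite nt_cod fdom.
  transitivity (cmp _ _ e1).
    by apply: cmp_congr => //; congr (a h (cod (bp f h _))); exact: val_inj.
  rewrite (nt_nat e1 e2); apply: cmp_congr => //.
  by congr (fmor _ (bp f h _)); exact: val_inj.
Defined.

Definition boxN (C D : category) (u v : functor C D) (tau : nattrans u v) n
  (X : 'I_n -> mquiver C) (Y : 'I_n -> mquiver D)
  (F : forall h, mqfun u (X h) (Y h)) (G : forall h, mqfun v (X h) (Y h))
  (a : forall h, mqnat tau (F h) (G h)) : mqnat tau (boxF F) (boxF G).
Proof.
refine (@Mqnat _ _ u v tau (boxQ X) (boxQ Y) (boxF F) (boxF G)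
  (boxN_nattrans a) _ _).
- exact: (proj1 (box_map_span (fun h => mqn_span (a h)))).
- exact: (proj2 (box_map_span (fun h => mqn_span (a h)))).
Defined.

Lemma emb_tree n m (f : osk n m) (t t' : tree n) (e : t = t') (g : 'I_m)
    (k : 'I_(fib f g).+1) (c : 'I_(lev t (psi f (hi g))))
    (c' : 'I_(lev t' (psi f (hi g)))) (i : 'I_(lev (tree_fib c) k))
    (i' : 'I_(lev (tree_fib c') k)) :
  val c = val c' -> val i = val i' -> val (emb i) = val (emb i').
Proof.
by subst t' => ec; have ec' := val_inj ec; subst c' => ei; congr (val (emb _)); exact: val_inj.
Qed.

Section RegroupFunctor.
Variables (C : category) (X : mquiver C) (n m : nat) (f : osk n m).

Let regO := @regroup (Ob C) (obS X) n m f.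
Let regM := @regroup (Mor C) (morS X) n m f.

Definition regroup_functor :
  functor (boxC n X) (boxQ (fun g : 'I_m => boxC (fib f g) X)).
Proof.
refine (@Functor (boxC n X) (boxQ (fun g : 'I_m => boxC (fib f g) X))
  regO regM _ _ _ _).
- move=> x; apply: Box_eq => // g c; apply: Box_eq => //.
- move=> x; apply: Box_eq => // g c; apply: Box_eq => //.
- move=> x; apply: Box_eq => // g c; apply: Box_eq => //.
- move=> y x e e'; apply: Box_eq => h b /=.
    by apply: cmp_congr => //; congr (bl y _ _); exact: val_inj.
  apply: Box_eq => k b' /=.
    apply: cmp_congr => //; congr (bl y _ _); apply: val_inj => /=.
    apply: emb_tree => //; exact: (box_cmp_tree e).
  apply: cmp_congr => //; congr (bp y _ _); apply: val_inj => /=.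
  apply: emb_tree => //; exact: (box_cmp_tree e).
Defined.

Lemma regroup_src A (Y : span A) (x : box (fun _ : 'I_n => Y)) :
  box_src (regroup f x) = map id (box_src x).
Proof. by rewrite map_id /box_src /= psi0. Qed.

Lemma regroup_tgt A (Y : span A) (x : box (fun _ : 'I_n => Y)) :
  box_tgt (regroup f x) = box_tgt x.
Proof.
rewrite /box_tgt /= -(bl_cast (psi_max f)); congr (bl x _ _); exact: top_uniq.
Qed.

Definition regroupF :
  mqfun (idF C) (boxC n X) (boxQ (fun g : 'I_m => boxC (fib f g) X)).
Proof.
refine (@Mqfun _ _ (idF C) _ _ regroup_functor _ _).
- by split=> x; exact: regroup_src.
- by split=> x; exact: regroup_tgt.
Defined.

End RegroupFunctor.

(* P : boxdot^1 X -> X sends (t, l, p) to its only label p. *)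

Lemma hi1 : hi (ord0 : 'I_1) = ord_max.
Proof. exact: val_inj. Qed.

Lemma lo1 : lo (ord0 : 'I_1) = ord0.
Proof. exact: val_inj. Qed.

Definition top1 (t : tree 1) : 'I_(lev t (hi ord0)) :=
  cast_ord (congr1 (lev t) (esym hi1)) (tree_top t).

Lemma top1_uniq (t : tree 1) (b : 'I_(lev t (hi ord0))) : b = top1 t.
Proof.
rewrite /top1 -(top_uniq (cast_ord (congr1 (lev t) hi1) b)); exact: val_inj.
Qed.

Section Unbox.
Variables (C : category) (X : mquiver C).

Definition unbox_set A (Y : span A) (x : box (fun _ : 'I_1 => Y)) : Y :=
  bp x ord0 (top1 (bt x)).

Lemma unbox_src A (Y : span A) (x : box (fun _ : 'I_1 => Y)) :
  ssrc (unbox_set x) = map id (box_src x).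
Proof.
rewrite map_id [LHS](bp_src (top1 (bt x))).
have -> : pre (tmap (bt x) (lohi ord0)) (top1 (bt x)) = setT.
  by apply/setP => a; rewrite !inE; apply/eqP; exact: top1_uniq.
by rewrite /box_src -lo1 enum_setT -enumT.
Qed.

Lemma unbox_tgt A (Y : span A) (x : box (fun _ : 'I_1 => Y)) :
  stgt (unbox_set x) = box_tgt x.
Proof. by rewrite bp_tgt /top1 bl_cast. Qed.

Definition unbox_functor : functor (boxC 1 X) X.
Proof.
refine (@Functor (boxC 1 X) X (@unbox_set _ (obS X)) (@unbox_set _ (morS X))
  _ _ _ _) => //.
by move=> g f e e'; apply: cmp_congr => //=; congr (bp g _ _); exact: top1_uniq.
Defined.

Definition unbox : mqfun (idF C) (boxC 1 X) X.
Proof.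
refine (@Mqfun _ _ (idF C) (boxC 1 X) X unbox_functor _ _).
- split; first exact: (@unbox_src _ (obS X)).
  exact: (@unbox_src _ (morS X)).
- split; first exact: (@unbox_tgt _ (obS X)).
  exact: (@unbox_tgt _ (morS X)).
Defined.

End Unbox.

Section Acts.
Variables (C : category) (X : mquiver C).
Variable act : forall n, mqfun (idF C) (boxC n X) X.

Definition actf n m (f : osk n m) : mqfun (idF C) (boxC n X) (boxC m X) :=
  mqcmpl (boxF (fun j : 'I_m => act (fib f j))) (regroupF X f).

(* P and rho for an index set with one element, identified with 1. *)
Definition unbox_at k (e : 1 = k) : mqfun (idF C) (boxC k X) X :=
  match e in _ = k' return mqfun (idF C) (boxC k' X) X with
  | erefl => unbox X
  end.

Definition rho_at (rho : mqnat (idN (idF C)) (act 1) (unbox X)) k (e : 1 = k) :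
    mqnat (idN (idF C)) (act k) (unbox_at e) :=
  match e as e' in _ = k' return mqnat (idN (idF C)) (act k') (unbox_at e') with
  | erefl => rho
  end.

End Acts.

Lemma fib_osk_id n (i : 'I_n) : 1 = fib (osk_id n) i.
Proof. by rewrite fib_id. Qed.

(* f_c : f^-1 g^-1 c -> g^-1 c, the restriction of f *)
Definition osk_restr n m k (f : osk n m) (g : osk m k) (c : 'I_k) :
    osk (fib (osk_comp g f) c) (fib g c) :=
  @restr n m k f g (osk_comp g f) (fun _ => erefl) c.

(* act n is circledast^I and actf act f is circledast^f, for #|I| = n.
   Transformations with equal underlying families but whose (equal) end functors
   are written differently are compared by components. *)
Record laxsmc := Laxsmc {
  smbase : category;
  smquiv : mquiver smbase;
  act : forall n, mqfun (idF smbase) (boxC n smquiv) smquiv;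
  lam : forall n m (f : osk n m),
    mqnat (idN (idF smbase)) (act n) (mqcmpl (act m) (actf act f));
  rho : mqnat (idN (idF smbase)) (act 1) (unbox smquiv);
  lam_id : forall n x,
    vcmp (whiskl (act n)
            (whiskr (boxN (fun i => rho_at rho (fib_osk_id i)))
               (regroupF smquiv (osk_id n))))
         (lam (osk_id n)) x
    = idN (act n) x;
  lam_to1 : forall n x,
    vcmp (whiskr rho (actf act (osk_to1 n))) (lam (osk_to1 n)) x
    = idN (act n) x;
  lam_comp : forall n m k (f : osk n m) (g : osk m k) x,
    vcmp (whiskr (lam g) (actf act f)) (lam f) x
    = vcmp (whiskl (act k)
              (whiskr (boxN (fun c => lam (osk_restr f g c)))
                 (regroupF smquiv (osk_comp g f))))
           (lam (osk_comp g f)) x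
}.

Lemma actf_box (L M : laxsmc) (u : functor (smbase L) (smbase M))
    (F : mqfun u (smquiv L) (smquiv M)) n m (f : osk n m) :
  feq (cmpF (cmpF (act M m) (actf (act M) f)) (boxF (fun _ : 'I_n => F)))
      (cmpF (act M m)
        (cmpF (boxF (fun j => mqcmpl (act M (fib f j)) (boxF (fun _ => F))))
           (regroupF (smquiv L) f))).
Proof.
split=> x /=.
  congr (act M m _); apply: Box_eq => // g c /=; congr (act M _ _).
  exact: Box_eq.
congr (fmor (act M m) _); apply: Box_eq => // g c /=; congr (fmor (act M _) _).
exact: Box_eq.
Qed.

Lemma box_actf (L M : laxsmc) (u : functor (smbase L) (smbase M))
    (F : mqfun u (smquiv L) (smquiv M)) n m (f : osk n m) :
  feq (cmpF (act M m)
        (cmpF (boxF (fun j => mqcmpr F (act L (fib f j))))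
           (regroupF (smquiv L) f)))
      (cmpF (cmpF (act M m) (boxF (fun _ : 'I_m => F))) (actf (act L) f)).
Proof.
by split=> x /=; [congr (fob (act M m) _) | congr (fmor (act M m) _)]; exact: Box_eq.
Qed.

Record multifun (L M : laxsmc) := Multifun {
  mfbase : functor (smbase L) (smbase M);
  mfquiv : mqfun mfbase (smquiv L) (smquiv M);
  phi : forall n, mqnat (idN mfbase)
    (mqcmpl (act M n) (boxF (fun _ : 'I_n => mfquiv))) (mqcmpr mfquiv (act L n));
  phi_rho : forall x,
    vcmp (whiskl mfquiv (rho L)) (phi 1) x
    = whiskr (rho M) (boxF (fun _ : 'I_1 => mfquiv)) x;
  phi_lam : forall n m (f : osk n m) x,
    vcmp (whiskr (phi m) (actf (act L) f))
         (convN (box_actf mfquiv f)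
           (vcmp (whiskl (act M m)
                   (whiskr (boxN (fun j => phi (fib f j))) (regroupF (smquiv L) f)))
                 (convN (actf_box mfquiv f)
                   (whiskr (lam M f) (boxF (fun _ : 'I_n => mfquiv)))))) x
    = vcmp (whiskl mfquiv (lam L f)) (phi n) x
}.

Record multinat (L M : laxsmc) (F G : multifun L M) := Multinat {
  mnbase : nattrans (mfbase F) (mfbase G);
  mnquiv : mqnat mnbase (mfquiv F) (mfquiv G);
  mn_phi : forall n x,
    vcmp (phi G n) (whiskl (act M n) (boxN (fun _ : 'I_n => mnquiv))) x
    = vcmp (whiskr mnquiv (act L n)) (phi F n) x
}.

Lemma cmpF_assoc (B C D E : category) (H : functor D E) (G : functor C D)
  (F : functor B C) : feq (cmpF (cmpF H G) F) (cmpF H (cmpF G F)).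
Proof. by []. Qed.

(* The transformation (G phi^I) . (psi^I boxdot^I F) of a composite G F *)
Definition comp_phi (L M N : laxsmc) (G : multifun M N) (F : multifun L M) n :=
  vcmp (whiskl (mfquiv G) (phi F n))
    (convN (cmpF_assoc (mfquiv G) (act M n) (boxF (fun _ : 'I_n => mfquiv F)))
       (whiskr (phi G n) (boxF (fun _ : 'I_n => mfquiv F)))).

(* Equality of 2-cells whose end 1-cells are only provably equal. *)
Definition cell_eq (A : Type) (H : A -> A -> Type) (F G F' G' : A)
    (a : H F G) (b : H F' G') : Prop :=
  existT (fun p : A * A => H p.1 p.2) (F, G) a
  = existT (fun p : A * A => H p.1 p.2) (F', G') b.

(* Strict 2-categories with given objects, 1-cells and 2-cells. *)
Record two_category (O : Type) (H1 : O -> O -> Type)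
    (H2 : forall X Y : O, H1 X Y -> H1 X Y -> Type) := TwoCategory {
  id1 : forall X, H1 X X;
  comp1 : forall X Y Z, H1 Y Z -> H1 X Y -> H1 X Z;
  id2 : forall X Y (F : H1 X Y), H2 X Y F F;
  vcomp : forall X Y (F G H : H1 X Y), H2 X Y G H -> H2 X Y F G -> H2 X Y F H;
  hcomp : forall X Y Z (G G' : H1 Y Z) (F F' : H1 X Y),
    H2 Y Z G G' -> H2 X Y F F' -> H2 X Z (comp1 G F) (comp1 G' F');
  vcomp_idl : forall X Y (F G : H1 X Y) (a : H2 X Y F G), vcomp (id2 G) a = a;
  vcomp_idr : forall X Y (F G : H1 X Y) (a : H2 X Y F G), vcomp a (id2 F) = a;
  vcompA : forall X Y (F G H K : H1 X Y)
    (c : H2 X Y H K) (b : H2 X Y G H) (a : H2 X Y F G),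
    vcomp c (vcomp b a) = vcomp (vcomp c b) a;
  hcomp_id2 : forall X Y Z (G : H1 Y Z) (F : H1 X Y),
    hcomp (id2 G) (id2 F) = id2 (comp1 G F);
  interchange : forall X Y Z (G G' G'' : H1 Y Z) (F F' F'' : H1 X Y)
    (b' : H2 Y Z G' G'') (b : H2 Y Z G G') (a' : H2 X Y F' F'') (a : H2 X Y F F'),
    hcomp (vcomp b' b) (vcomp a' a) = vcomp (hcomp b' a') (hcomp b a);
  comp1_idl : forall X Y (F : H1 X Y), comp1 (id1 Y) F = F;
  comp1_idr : forall X Y (F : H1 X Y), comp1 F (id1 X) = F;
  comp1A : forall X Y Z W (H : H1 Z W) (G : H1 Y Z) (F : H1 X Y),
    comp1 H (comp1 G F) = comp1 (comp1 H G) F;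
  hcomp_idl : forall X Y (F G : H1 X Y) (a : H2 X Y F G),
    cell_eq (H := @H2 X Y) (hcomp (id2 (id1 Y)) a) a;
  hcomp_idr : forall X Y (F G : H1 X Y) (a : H2 X Y F G),
    cell_eq (H := @H2 X Y) (hcomp a (id2 (id1 X))) a;
  hcompA : forall X Y Z W (H H' : H1 Z W) (G G' : H1 Y Z) (F F' : H1 X Y)
    (c : H2 Z W H H') (b : H2 Y Z G G') (a : H2 X Y F F'),
    cell_eq (H := @H2 X W) (hcomp c (hcomp b a)) (hcomp (hcomp c b) a)
}.

(* Main.v *)
(** Both sides of every law are computed objectwise, so the 2-category axioms
    reduce to those of strict composition of functors and natural transformations
    once equality of 1-cells and 2-cells is reduced to equality of components. What
    has to be checked is that composites of 1-cells and of 2-cells are again such: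
    their coherence equations are pasted from those of the factors, using the
    naturality of the transformations phi. *)

Require Import Defs.
From mathcomp Require Import all_boot.
From Stdlib Require Import FunctionalExtensionality ProofIrrelevance.
From Stdlib Require Import ClassicalEpsilon.

Set Implicit Arguments.
Unset Strict Implicit.
Unset Printing Implicit Defensive.

(** * Extensionality of functors, transformations, 1-cells and 2-cells *)

(** Since [Mor] is a single type, the type of [fmor] does not depend on [fob], so the two maps are
    replaced separately and without transport. *)
Lemma functor_eq (C D : category) (F G : functor C D) : feq F G -> F = G.
Proof.
case: F => o m p1 p2 p3 p4; case: G => o' m' p1' p2' p3' p4' [/= eo em].
have E := functional_extensionality _ _ eo.
have E' := functional_extensionality _ _ em.
subst o' m'; congr Functor; exact: proof_irrelevance.
Qed.

Lemma nattrans_eq (C D : category) (F G : functor C D) (a b : nattrans F G) :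
  (forall x, a x = b x) -> a = b.
Proof.
case: a => a p1 p2 p3; case: b => b p1' p2' p3' /= e.
have E := functional_extensionality _ _ e.
subst b; congr Nattrans; exact: proof_irrelevance.
Qed.

Lemma mqfun_eq (C D : category) (u : functor C D) (X : mquiver C)
    (Y : mquiver D) (F G : mqfun u X Y) : feq F G -> F = G.
Proof.
case: F => F p1 p2; case: G => G p1' p2' /= /functor_eq e.
subst G; congr Mqfun; exact: proof_irrelevance.
Qed.

Lemma mqnat_eq (C D : category) (u v : functor C D) (tau : nattrans u v)
    (X : mquiver C) (Y : mquiver D) (F : mqfun u X Y) (G : mqfun v X Y)
    (a b : mqnat tau F G) : (forall x, a x = b x) -> a = b.
Proof.
case: a => a p1 p2; case: b => b p1' p2' /= /nattrans_eq e.
subst b; congr Mqnat; exact: proof_irrelevance.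
Qed.

(** The fields are identified in the order of their dependency. Components of [phi] are plain
    morphisms of [M], so the third hypothesis makes sense before the underlying functors are known
    to be equal. *)
Lemma multifun_eq (L M : laxsmc) (F G : multifun L M) :
  feq (mfbase F) (mfbase G) -> feq (mfquiv F) (mfquiv G) ->
  (forall n x, phi F n x = phi G n x) -> F = G.
Proof.
case: F => u F p r l; case: G => v G q r' l' euv.
have {euv} E : u = v by exact: functor_eq euv.
case: v / E G q r' l' => G q r' l' eFG.
have {eFG} E : F = G by exact: mqfun_eq eFG.
case: G / E q r' l' => q r' l' epq.
have {epq} E : p = q.
  by apply: functional_extensionality_dep => n; apply: mqnat_eq; exact: epq.
case: q / E r' l' => r' l'.
rewrite (proof_irrelevance _ r r') (proof_irrelevance _ l l').
reflexivity.
Qed.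

Lemma multinat_eq (L M : laxsmc) (F G : multifun L M) (a b : multinat F G) :
  (forall x, mnbase a x = mnbase b x) -> (forall x, mnquiv a x = mnquiv b x) ->
  a = b.
Proof.
case: a => s a p; case: b => s' b p' /= /nattrans_eq e.
subst s' => /mqnat_eq e'; subst b; congr Multinat; exact: proof_irrelevance.
Qed.

(** The type of a component does not mention the end 1-cells; once the ends are identified, this is
    equality of parallel 2-cells. *)
Lemma multinat_cell_eq (L M : laxsmc) (F F' G G' : multifun L M)
    (a : multinat F G) (b : multinat F' G') :
  F = F' -> G = G' -> (forall x, mnbase a x = mnbase b x) ->
  (forall x, mnquiv a x = mnquiv b x) -> cell_eq (H := @multinat L M) a b.
Proof.
by move=> eF eG; subst F' G' => ea eb; rewrite /cell_eq (multinat_eq ea eb).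
Qed.

(** * Total composition and its rules *)

(* Composition made total, with the junk value g if dom g <> cod f, so that
   equations can be rewritten without carrying composability proofs. *)
Definition tcmp (C : category) (g f : Mor C) : Mor C :=
  match excluded_middle_informative (dom g = cod f) with
  | left e => cmp g f e
  | right _ => g
  end.

Notation "g \oo f" := (tcmp g f) (at level 50, left associativity).

Lemma cmpE (C : category) (g f : Mor C) e : cmp g f e = g \oo f.
Proof.
by rewrite /tcmp; case: excluded_middle_informative => // e'; exact: cmp_congr.
Qed.

Lemma dom_tcmp (C : category) (g f : Mor C) :
  dom g = cod f -> dom (g \oo f) = dom f.
Proof. by move=> e; rewrite -(cmpE e) dom_cmp. Qed.

Lemma cod_tcmp (C : category) (g f : Mor C) :
  dom g = cod f -> cod (g \oo f) = cod g.
Proof. by move=> e; rewrite -(cmpE e) cod_cmp. Qed.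

Lemma tcmpA (C : category) (h g f : Mor C) :
  dom h = cod g -> dom g = cod f -> h \oo (g \oo f) = h \oo g \oo f.
Proof.
move=> e3 e1.
have e2 : dom h = cod (cmp g f e1) by rewrite cod_cmp.
have e4 : dom (cmp h g e3) = cod f by rewrite dom_cmp.
by have := cmpA e2 e4; rewrite !cmpE.
Qed.

(** The object is a variable, so that rewriting matches any identity and leaves its endpoint as a
    side goal. *)
Lemma tcmp_idl (C : category) (x : Ob C) (f : Mor C) :
  cod f = x -> idm x \oo f = f.
Proof. by move=> <-; rewrite -(cmpE (dom_idm _)) cmp_idl. Qed.

Lemma tcmp_idr (C : category) (x : Ob C) (f : Mor C) :
  dom f = x -> f \oo idm x = f.
Proof. by move=> <-; rewrite -(cmpE (esym (cod_idm _))) cmp_idr. Qed.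

Lemma ftcmp (C D : category) (F : functor C D) (g f : Mor C) :
  dom g = cod f -> fmor F (g \oo f) = fmor F g \oo fmor F f.
Proof.
move=> e; have e' : dom (fmor F g) = cod (fmor F f) by rewrite fdom fcod e.
by rewrite -(cmpE e) -(cmpE e'); exact: fcmp.
Qed.

Lemma nt_tcmp (C D : category) (F G : functor C D) (a : nattrans F G) f :
  a (cod f) \oo fmor F f = fmor G f \oo a (dom f).
Proof.
have e : dom (a (cod f)) = cod (fmor F f) by rewrite nt_dom fcod.
have e' : dom (fmor G f) = cod (a (dom f)) by rewrite nt_cod fdom.
by rewrite -(cmpE e) -(cmpE e'); exact: nt_nat.
Qed.

Lemma vcmpE (C D : category) (F G H : functor C D) (b : nattrans G H)
  (a : nattrans F G) x : vcmp b a x = b x \oo a x.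
Proof. exact: cmpE. Qed.

Lemma whisklE (C D E : category) (H : functor D E) (F G : functor C D)
  (a : nattrans F G) x : whiskl H a x = fmor H (a x).
Proof. by []. Qed.

Lemma whiskrE (C D E : category) (F G : functor D E) (a : nattrans F G)
  (H : functor C D) x : whiskr a H x = a (H x).
Proof. by []. Qed.

Lemma hcmpE (C D E : category) (G G' : functor D E) (F F' : functor C D)
  (b : nattrans G G') (a : nattrans F F') x :
  hcmp b a x = b (F' x) \oo fmor G (a x).
Proof. exact: cmpE. Qed.

(** * Total composition in sequences and in boxes *)

(** Both sequences are indexed by [s], so composability in [star C] follows from that of the
    entries. This computes sources of composites. *)
Lemma star_tcmp (C : category) (I : Type) (g f : I -> Mor C) (s : seq I) :
  (forall i, dom (g i) = cod (f i)) ->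
  tcmp (C := star C) (map g s) (map f s) = [seq g i \oo f i | i <- s].
Proof.
move=> e; rewrite -(@cmpE (star C) _ _ (scmp_map_def s e)) /= (scmp_map e).
by apply: eq_map => i; exact: cmpE.
Qed.

(** Both factors have literally the tree [t], so the casts in [box_cmp] do not change indices and
    composition is labelwise. *)
Lemma Box_tcmp (C : category) n (X : 'I_n -> mquiver C) (t : tree n)
    l l1 l2 p p1 p2 H1 H2 H11 H12 H21 H22 :
  (forall h b, dom (l2 h b) = cod (l1 h b)) ->
  (forall h b, dom (p2 h b) = cod (p1 h b)) ->
  (forall h b, l h b = l2 h b \oo l1 h b) ->
  (forall h b, p h b = p2 h b \oo p1 h b) ->
  @Box (Mor C) n (fun h => morS (X h)) t l p H1 H2
  = tcmp (C := boxQ X) (@Box (Mor C) n (fun h => morS (X h)) t l2 p2 H21 H22)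
      (@Box (Mor C) n (fun h => morS (X h)) t l1 p1 H11 H12).
Proof.
move=> dl dp el ep.
set y := Box H21 H22; set x := Box H11 H12.
have e : box_dom (X := X) y = box_cod (X := X) x by exact: Box_eq.
rewrite -(@cmpE (boxQ X) y x e); apply: Box_eq => h b.
  by rewrite cmpE el; congr (l2 h _ \oo _); exact: val_inj.
by rewrite cmpE ep; congr (p2 h _ \oo _); exact: val_inj.
Qed.

(** * Composition of functors and transformations over multiquivers *)

Lemma mqnat_cmp_src (C D : category) (u v w : functor C D) (s : nattrans u v)
    (t : nattrans v w) (X : mquiver C) (Y : mquiver D) (F : mqfun u X Y)
    (G : mqfun v X Y) (H : mqfun w X Y) (a : mqnat s F G) (b : mqnat t G H) x :
  fmor (msrc Y) (b x \oo a x) = map (vcmp t s) (msrc X x).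
Proof.
rewrite ftcmp ?nt_dom ?nt_cod // !mqn_src star_tcmp => [|i].
  by apply: eq_map => i; rewrite vcmpE.
by rewrite nt_dom nt_cod.
Qed.

Lemma mqnat_cmp_tgt (C D : category) (u v w : functor C D) (s : nattrans u v)
    (t : nattrans v w) (X : mquiver C) (Y : mquiver D) (F : mqfun u X Y)
    (G : mqfun v X Y) (H : mqfun w X Y) (a : mqnat s F G) (b : mqnat t G H) x :
  fmor (mtgt Y) (b x \oo a x) = vcmp t s (mtgt X x).
Proof. by rewrite ftcmp ?nt_dom ?nt_cod // !mqn_tgt vcmpE. Qed.

Definition mqvcmp (C D : category) (u v w : functor C D) (s : nattrans u v)
  (t : nattrans v w) (X : mquiver C) (Y : mquiver D) (F : mqfun u X Y)
  (G : mqfun v X Y) (H : mqfun w X Y) (b : mqnat t G H) (a : mqnat s F G) :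
  mqnat (vcmp t s) F H.
Proof.
refine (@Mqnat _ _ u w (vcmp t s) X Y F H (vcmp b a) _ _) => x.
- by rewrite vcmpE; exact: mqnat_cmp_src.
- by rewrite vcmpE; exact: mqnat_cmp_tgt.
Defined.

Definition mqidN (C D : category) (u : functor C D) (X : mquiver C)
  (Y : mquiver D) (F : mqfun u X Y) : mqnat (idN u) F F.
Proof.
refine (@Mqnat _ _ u u (idN u) X Y F F (idN F) _ _) => x /=.
- by rewrite fidm /= [fob _ _](proj1 (mqf_src F)) /= -map_comp.
- by rewrite fidm [fob _ _](proj1 (mqf_tgt F)).
Defined.

Definition mqcmp (C D E : category) (v : functor D E) (u : functor C D)
  (X : mquiver C) (Y : mquiver D) (Z : mquiver E) (G : mqfun v Y Z)
  (F : mqfun u X Y) : mqfun (cmpF v u) X Z :=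
  mqcmp_gen (conj (fun=> erefl) (fun=> erefl)) G F.

Lemma mqf_srcE (C D : category) (u : functor C D) (X : mquiver C)
    (Y : mquiver D) (F : mqfun u X Y) x : msrc Y (F x) = map u (msrc X x).
Proof. exact: (proj1 (mqf_src F)). Qed.

Lemma mqf_srcM (C D : category) (u : functor C D) (X : mquiver C)
    (Y : mquiver D) (F : mqfun u X Y) f :
  fmor (msrc Y) (fmor F f) = map (fmor u) (fmor (msrc X) f).
Proof. exact: (proj2 (mqf_src F)). Qed.

Lemma mqf_tgtE (C D : category) (u : functor C D) (X : mquiver C)
    (Y : mquiver D) (F : mqfun u X Y) x : mtgt Y (F x) = u (mtgt X x).
Proof. exact: (proj1 (mqf_tgt F)). Qed.

Lemma mqf_tgtM (C D : category) (u : functor C D) (X : mquiver C)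
    (Y : mquiver D) (F : mqfun u X Y) f :
  fmor (mtgt Y) (fmor F f) = fmor u (fmor (mtgt X) f).
Proof. exact: (proj2 (mqf_tgt F)). Qed.

Definition mqhcmp (C D E : category) (v v' : functor D E) (u u' : functor C D)
  (t : nattrans v v') (s : nattrans u u')
  (X : mquiver C) (Y : mquiver D) (Z : mquiver E) (G : mqfun v Y Z)
  (G' : mqfun v' Y Z) (F : mqfun u X Y) (F' : mqfun u' X Y)
  (b : mqnat t G G') (a : mqnat s F F') :
  mqnat (hcmp t s) (mqcmp G F) (mqcmp G' F').
Proof.
refine (@Mqnat _ _ _ _ (hcmp t s) X Z (mqcmp G F) (mqcmp G' F') (hcmp b a) _ _)
  => x.
- rewrite [X in fmor _ X](hcmpE b a) ftcmp ?nt_dom ?fcod ?nt_cod //.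
  rewrite mqf_srcM !mqn_src mqf_srcE -!map_comp.
  rewrite star_tcmp => [|i /=]; last by rewrite nt_dom fcod nt_cod.
  by apply: eq_map => i; rewrite hcmpE.
- rewrite [X in fmor _ X](hcmpE b a) ftcmp ?nt_dom ?fcod ?nt_cod //.
  rewrite mqf_tgtM !mqn_tgt mqf_tgtE.
  by rewrite hcmpE.
Defined.

(** * Boxes of composites and of identities *)

Lemma boxF_cmp (C D E : category) (v : functor D E) (u : functor C D) n
    (X : 'I_n -> mquiver C) (Y : 'I_n -> mquiver D) (Z : 'I_n -> mquiver E)
    (G : forall h, mqfun v (Y h) (Z h)) (F : forall h, mqfun u (X h) (Y h)) :
  feq (boxF (fun h => mqcmp (G h) (F h))) (cmpF (boxF G) (boxF F)).
Proof. by split=> x; exact: Box_eq. Qed.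

Lemma boxN_id (C D : category) (u : functor C D) n (X : 'I_n -> mquiver C)
    (Y : 'I_n -> mquiver D) (F : forall h, mqfun u (X h) (Y h)) x :
  boxN (fun h => mqidN (F h)) x = idm (boxF F x).
Proof. exact: Box_eq. Qed.

Lemma boxN_vcmp (C D : category) (u v w : functor C D) (s : nattrans u v)
    (t : nattrans v w) n (X : 'I_n -> mquiver C) (Y : 'I_n -> mquiver D)
    (F : forall h, mqfun u (X h) (Y h)) (G : forall h, mqfun v (X h) (Y h))
    (H : forall h, mqfun w (X h) (Y h)) (b : forall h, mqnat t (G h) (H h))
    (a : forall h, mqnat s (F h) (G h)) x :
  boxN (fun h => mqvcmp (b h) (a h)) x = boxN b x \oo boxN a x.
Proof.
by apply: Box_tcmp => h c; rewrite ?nt_dom ?nt_cod //=; exact: cmpE.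
Qed.

Lemma boxN_hcmp (C D E : category) (v v' : functor D E) (u u' : functor C D)
    (t : nattrans v v') (s : nattrans u u') n
    (X : 'I_n -> mquiver C) (Y : 'I_n -> mquiver D) (Z : 'I_n -> mquiver E)
    (G : forall h, mqfun v (Y h) (Z h)) (G' : forall h, mqfun v' (Y h) (Z h))
    (F : forall h, mqfun u (X h) (Y h)) (F' : forall h, mqfun u' (X h) (Y h))
    (b : forall h, mqnat t (G h) (G' h)) (a : forall h, mqnat s (F h) (F' h))
    x :
  boxN (fun h => mqhcmp (b h) (a h)) x
  = boxN b (boxF F' x) \oo fmor (boxF G) (boxN a x).
Proof.
by apply: Box_tcmp => h c; rewrite ?fcod ?nt_dom ?nt_cod //=; exact: cmpE.
Qed.

(* End functors such as boxF (G F) and boxF G \o boxF F agree on objects and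
   morphisms without being convertible; the components are unchanged. *)
Definition recastN (C D : category) (F F' G G' : functor C D) (eF : feq F F')
  (eG : feq G G') (a : nattrans F G) : nattrans F' G'.
Proof.
refine (@Nattrans C D F' G' a _ _ _).
- by move=> x; rewrite nt_dom (proj1 eF).
- by move=> x; rewrite nt_cod (proj1 eG).
- by move=> f e e'; rewrite !cmpE -(proj2 eF) -(proj2 eG); exact: nt_tcmp.
Defined.

Lemma recastNE (C D : category) (F F' G G' : functor C D) (eF : feq F F')
  (eG : feq G G') (a : nattrans F G) x : recastN eF eG a x = a x.
Proof. by []. Qed.

(** * The transformation [phi] of a composite 1-cell *)

Section Composite.
Variables (L M N : laxsmc) (G : multifun M N) (F : multifun L M).

Lemma comp_phiE n x :
  comp_phi G F n x = fmor (mfquiv G) (phi F n x)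
    \oo phi G n (boxF (fun _ : 'I_n => mfquiv F) x).
Proof. exact: cmpE. Qed.

(** [comp_phi] starts at the box of [G] after the box of [F], whereas a 1-cell requires the box of
    the composite. *)
Lemma comp_phi_dom n : feq
  (cmpF (mqcmpl (act N n) (boxF (fun _ : 'I_n => mfquiv G)))
     (boxF (fun _ : 'I_n => mfquiv F)))
  (mqcmpl (act N n) (boxF (fun _ : 'I_n => mqcmp (mfquiv G) (mfquiv F)))).
Proof.
have [eo em] := boxF_cmp (fun _ : 'I_n => mfquiv G) (fun _ : 'I_n => mfquiv F).
split=> x; first exact: (congr1 (fob (act N n)) (esym (eo x))).
exact: (congr1 (fmor (act N n)) (esym (em x))).
Qed.

Lemma comp_phi_cod n : feq
  (cmpF (mfquiv G) (mqcmpr (mfquiv F) (act L n)))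
  (mqcmpr (mqcmp (mfquiv G) (mfquiv F)) (act L n)).
Proof. by []. Qed.

Lemma comp_phi_composable n x :
  dom (fmor (mfquiv G) (phi F n x))
  = cod (phi G n (boxF (fun _ : 'I_n => mfquiv F) x)).
Proof. by rewrite fdom nt_dom nt_cod. Qed.

Definition mqcomp_phi n : mqnat (idN (cmpF (mfbase G) (mfbase F)))
  (mqcmpl (act N n) (boxF (fun _ : 'I_n => mqcmp (mfquiv G) (mfquiv F))))
  (mqcmpr (mqcmp (mfquiv G) (mfquiv F)) (act L n)).
Proof.
refine (@Mqnat _ _ _ _ _ _ _ _ _
  (recastN (@comp_phi_dom n) (@comp_phi_cod n) (comp_phi G F n)) _ _) => x.
- rewrite recastNE comp_phiE ftcmp ?comp_phi_composable //.
  (* Both factors lie over identities, so each entry of the source is an identity composed with the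
     image of an identity under [mfbase G]. *)
  rewrite mqf_srcM !mqn_src mqf_srcE -!map_comp star_tcmp => [|i /=].
    by apply: eq_map => i /=; rewrite fidm tcmp_idl ?cod_idm.
  by rewrite fidm dom_idm cod_idm.
- rewrite recastNE comp_phiE ftcmp ?comp_phi_composable //.
  rewrite mqf_tgtM !mqn_tgt mqf_tgtE /=.
  by rewrite fidm tcmp_idl ?cod_idm.
Defined.

Lemma mqcomp_phiE n x :
  mqcomp_phi n x = fmor (mfquiv G) (phi F n x)
    \oo phi G n (boxF (fun _ : 'I_n => mfquiv F) x).
Proof.
by rewrite -comp_phiE /mqcomp_phi; cbn [mqn]; rewrite recastNE.
Qed.

Lemma boxN_phi n m (f : osk n m) x :
  boxN (fun j => mqcomp_phi (fib f j)) (regroupF (smquiv L) f x)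
  = fmor (boxF (fun _ : 'I_m => mfquiv G))
      (boxN (fun j => phi F (fib f j)) (regroupF (smquiv L) f x))
    \oo boxN (fun j => phi G (fib f j))
      (regroupF (smquiv M) f (boxF (fun _ : 'I_n => mfquiv F) x)).
Proof.
(* Regrouping commutes with applying [F], but only up to the proofs stored in the labels, so the
   argument of [phi G] must be rewritten. *)
have E h b : bp (regroupF (smquiv M) f (boxF (fun _ : 'I_n => mfquiv F) x)) h b
    = boxF (fun _ : 'I_(fib f h) => mfquiv F)
        (bp (regroupF (smquiv L) f x) h b).
  exact: Box_eq.
apply: Box_tcmp => h b.
- by rewrite fdom nt_dom nt_cod.
- by rewrite E; exact: comp_phi_composable.
- by rewrite [RHS]/= fidm tcmp_idl ?cod_idm.
- rewrite [RHS](congr1 (fun y => _ \oo phi G _ y) (E h b)).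
  rewrite mqcomp_phiE.
  reflexivity.
Qed.

End Composite.

(** * The coherence equations as equations of total composites *)

Lemma phi_rhoE (L M : laxsmc) (F : multifun L M) x :
  fmor (mfquiv F) (rho L x) \oo phi F 1 x
  = rho M (boxF (fun _ : 'I_1 => mfquiv F) x).
Proof. by rewrite -[RHS]phi_rho vcmpE. Qed.

Lemma phi_lamE (L M : laxsmc) (F : multifun L M) n m (f : osk n m) x :
  phi F m (actf (act L) f x)
  \oo (fmor (act M m)
         (boxN (fun j => phi F (fib f j)) (regroupF (smquiv L) f x))
       \oo lam M f (boxF (fun _ : 'I_n => mfquiv F) x))
  = fmor (mfquiv F) (lam L f x) \oo phi F n x.
Proof.
(* [convN] does not change components, so unfolding just these constants exposes the composites and
   leaves [phi] and [boxN] folded. *)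
move: (phi_lam F f x); cbn [vcmp nt convN whiskl whiskr].
by rewrite [LHS]cmpE [X in _ \oo X]cmpE [RHS]cmpE.
Qed.

Lemma mn_phiE (L M : laxsmc) (F G : multifun L M) (a : multinat F G) n x :
  phi G n x \oo fmor (act M n) (boxN (fun _ : 'I_n => mnquiv a) x)
  = mnquiv a (act L n x) \oo phi F n x.
Proof. by have := mn_phi a x; rewrite !vcmpE. Qed.

Lemma mqcmplM (C D : category) (u : functor C D) (X : mquiver C)
    (Y Z : mquiver D) (G : mqfun (idF D) Y Z) (F : mqfun u X Y) f :
  fmor (mqcmpl G F) f = fmor G (fmor F f).
Proof. by []. Qed.

Lemma mqcmprM (C D : category) (u : functor C D) (X Y : mquiver C)
    (Z : mquiver D) (G : mqfun u Y Z) (F : mqfun (idF C) X Y) f :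
  fmor (mqcmpr G F) f = fmor G (fmor F f).
Proof. by []. Qed.

Lemma phi_nat (L M : laxsmc) (F : multifun L M) n f :
  phi F n (cod f) \oo fmor (act M n) (fmor (boxF (fun _ : 'I_n => mfquiv F)) f)
  = fmor (mfquiv F) (fmor (act L n) f) \oo phi F n (dom f).
Proof. by have := nt_tcmp (phi F n) f; rewrite mqcmplM mqcmprM. Qed.

Lemma phi_dom (L M : laxsmc) (F : multifun L M) n x :
  dom (phi F n x) = act M n (boxF (fun _ : 'I_n => mfquiv F) x).
Proof. exact: nt_dom. Qed.

Lemma phi_cod (L M : laxsmc) (F : multifun L M) n x :
  cod (phi F n x) = mfquiv F (act L n x).
Proof. exact: nt_cod. Qed.

Lemma lam_dom (L : laxsmc) n m (f : osk n m) x : dom (lam L f x) = act L n x.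
Proof. exact: nt_dom. Qed.

Lemma lam_cod (L : laxsmc) n m (f : osk n m) x :
  cod (lam L f x) = act L m (actf (act L) f x).
Proof. exact: nt_cod. Qed.

Lemma boxN_phi_cod (L M : laxsmc) (F : multifun L M) n m (f : osk n m) x :
  cod (boxN (fun j => phi F (fib f j)) (regroupF (smquiv L) f x))
  = boxF (fun _ : 'I_m => mfquiv F) (actf (act L) f x).
Proof. by rewrite nt_cod; exact: Box_eq. Qed.

(** Applying [F] is exchanged with regrouping, whose labels are themselves boxes; hence the second
    [Box_eq] under [act M]. *)
Lemma boxN_phi_dom (L M : laxsmc) (F : multifun L M) n m (f : osk n m) x :
  dom (boxN (fun j => phi F (fib f j)) (regroupF (smquiv L) f x))
  = actf (act M) f (boxF (fun _ : 'I_n => mfquiv F) x).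
Proof.
rewrite nt_dom; apply: Box_eq => // g c; rewrite /=; congr (act M _ _).
exact: Box_eq.
Qed.

(** Three squares are pasted: [a b c1 c2 d] becomes [a q r c2 d], then [a q s t], then [u v t].
    Stating this for variables keeps the associativity side conditions small. *)
Lemma tcmp_paste (C : category) (a b c1 c2 d q r s t u v : Mor C) :
  b \oo c1 = q \oo r -> r \oo (c2 \oo d) = s \oo t ->
  a \oo (q \oo s) = u \oo v ->
  dom a = cod b -> dom b = cod c1 -> dom c1 = cod c2 -> dom c2 = cod d ->
  dom q = cod r -> dom r = cod c2 -> dom q = cod s -> dom s = cod t ->
  dom a = cod q -> dom u = cod v -> dom v = cod t ->
  a \oo b \oo (c1 \oo c2 \oo d) = u \oo (v \oo t).
Proof.
move=> e1 e2 e3 ab bc1 c12 c2d qr rc2 qs st aq uv vt.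
transitivity (a \oo (q \oo (r \oo (c2 \oo d)))).
  rewrite (@tcmpA C q r) ?cod_tcmp // -e1 -(@tcmpA C c1 c2 d) //.
  by rewrite -(@tcmpA C a b) -?(@tcmpA C b c1) ?dom_tcmp ?cod_tcmp.
by rewrite e2 (@tcmpA C q s) // tcmpA ?dom_tcmp ?cod_tcmp // e3 -tcmpA.
Qed.

(** * Coherence of composite 1-cells *)

Section CompositeMultifun.
Variables (L M N : laxsmc) (G : multifun M N) (F : multifun L M).

Lemma mqcomp_phi_rho x :
  vcmp (whiskl (mqcmp (mfquiv G) (mfquiv F)) (rho L)) (mqcomp_phi G F 1) x
  = whiskr (rho N) (boxF (fun _ : 'I_1 => mqcmp (mfquiv G) (mfquiv F))) x.
Proof.
rewrite vcmpE mqcomp_phiE.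
have [eo _] := boxF_cmp (fun _ : 'I_1 => mfquiv G) (fun _ : 'I_1 => mfquiv F).
have -> : whiskr (rho N) (boxF (fun _ : 'I_1 => mqcmp (mfquiv G) (mfquiv F))) x
    = rho N (boxF (fun _ : 'I_1 => mfquiv G)
        (boxF (fun _ : 'I_1 => mfquiv F) x)).
  by rewrite whiskrE eo.
(* First [phi_rho] for [G] at the box of [F], then [phi_rho] for [F] under [G]. *)
rewrite -phi_rhoE -phi_rhoE ftcmp ?fdom ?nt_dom ?nt_cod //.
rewrite whisklE [LHS]tcmpA ?comp_phi_composable //.
by rewrite !fdom nt_dom fcod nt_cod.
Qed.

Lemma boxN_phi_composable n m (f : osk n m) x :
  dom (fmor (boxF (fun _ : 'I_m => mfquiv G))
    (boxN (fun j => phi F (fib f j)) (regroupF (smquiv L) f x)))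
  = cod (boxN (fun j => phi G (fib f j))
      (regroupF (smquiv M) f (boxF (fun _ : 'I_n => mfquiv F) x))).
Proof. by rewrite fdom boxN_phi_dom boxN_phi_cod. Qed.

(* The left-hand side is, reading right to left, lam N, phi G inside the boxes,
   G (phi F) inside the boxes, phi G, G (phi F). Naturality of phi G exchanges the
   third and fourth factors, after which phi_lam for G applies to the first three
   and then phi_lam for F, under G, to the rest. *)
Lemma mqcomp_phi_lam n m (f : osk n m) x :
  vcmp (whiskr (mqcomp_phi G F m) (actf (act L) f))
    (convN (box_actf (mqcmp (mfquiv G) (mfquiv F)) f)
      (vcmp
        (whiskl (act N m)
          (whiskr (boxN (fun j => mqcomp_phi G F (fib f j)))
            (regroupF (smquiv L) f)))
        (convN (actf_box (mqcmp (mfquiv G) (mfquiv F)) f)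
          (whiskr (lam N f)
            (boxF (fun _ : 'I_n => mqcmp (mfquiv G) (mfquiv F))))))) x
  = vcmp (whiskl (mqcmp (mfquiv G) (mfquiv F)) (lam L f)) (mqcomp_phi G F n) x.
Proof.
cbn [vcmp nt convN whiskl whiskr].
rewrite [LHS]cmpE [X in _ \oo X]cmpE [RHS]cmpE.
rewrite boxN_phi !mqcomp_phiE.
rewrite (ftcmp (act N m) (boxN_phi_composable f x)).
(* The goal determines all morphisms but [q], [r] and [s]: naturality of [phi G] gives [q] and [r],
   and [phi_lam] for [G] gives [s]. After the three squares only composability conditions remain. *)
apply: tcmp_paste.
- rewrite -(boxN_phi_cod F f x); exact: phi_nat.
- have [eo _] := boxF_cmp (fun _ : 'I_n => mfquiv G) (fun _ : 'I_n => mfquiv F).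
  by rewrite boxN_phi_dom eo; exact: phi_lamE.
- rewrite -!ftcmp; first (by rewrite phi_lamE ftcmp // fdom phi_cod lam_dom).
  + rewrite phi_dom cod_tcmp ?fcod ?boxN_phi_cod //.
    by rewrite fdom boxN_phi_dom lam_cod.
  + by rewrite fdom boxN_phi_dom lam_cod.
- exact: comp_phi_composable.
- by rewrite phi_dom !fcod boxN_phi_cod.
- by rewrite fdom boxN_phi_composable fcod.
- have [eo _] := boxF_cmp (fun _ : 'I_n => mfquiv G) (fun _ : 'I_n => mfquiv F).
  by rewrite eo fdom boxN_phi_dom lam_cod.
- by rewrite !fdom phi_cod boxN_phi_dom.
- by rewrite phi_dom fcod boxN_phi_cod boxN_phi_dom.
- by rewrite !fdom fcod boxN_phi_dom lam_cod.
- by rewrite fdom phi_cod lam_dom.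
- by rewrite fdom phi_dom !fcod boxN_phi_cod.
- by rewrite !fdom fcod lam_dom phi_cod.
- exact: comp_phi_composable.
Qed.

End CompositeMultifun.

Definition multifun_comp (L M N : laxsmc) (G : multifun M N)
  (F : multifun L M) : multifun L N :=
  @Multifun L N (cmpF (mfbase G) (mfbase F)) (mqcmp (mfquiv G) (mfquiv F))
    (mqcomp_phi G F) (mqcomp_phi_rho G F) (@mqcomp_phi_lam L M N G F).

(** * Identity 1-cells *)

Definition mqid (C : category) (X : mquiver C) : mqfun (idF C) X X.
Proof.
by refine (@Mqfun _ _ (idF C) X X (idF X) _ _); split=> x //=; rewrite map_id.
Defined.

(** A box is not convertible to the box rebuilt from its fields, so it is destructed first. *)
Lemma boxF_mqid (C : category) n (X : 'I_n -> mquiver C) :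
  feq (boxF (fun h => mqid (X h))) (idF (boxQ X)).
Proof. by split=> -[t l p H1 H2]; exact: Box_eq. Qed.

Section IdentityMultifun.
Variable L : laxsmc.

Lemma id_phi_dom n :
  feq (act L n) (mqcmpl (act L n) (boxF (fun _ : 'I_n => mqid (smquiv L)))).
Proof.
have [eo em] := boxF_mqid (fun _ : 'I_n => smquiv L).
split=> x; first exact: (congr1 (fob (act L n)) (esym (eo x))).
exact: (congr1 (fmor (act L n)) (esym (em x))).
Qed.

Lemma id_phi_cod n : feq (act L n) (mqcmpr (mqid (smquiv L)) (act L n)).
Proof. by []. Qed.

(** This is the identity of [act L n], recast because the box of an identity functor equals the
    identity without being convertible to it. *)
Definition id_phi n : mqnat (idN (idF (smbase L)))
  (mqcmpl (act L n) (boxF (fun _ : 'I_n => mqid (smquiv L))))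
  (mqcmpr (mqid (smquiv L)) (act L n)).
Proof.
refine (@Mqnat _ _ _ _ _ _ _ _ _
  (recastN (id_phi_dom n) (id_phi_cod n) (idN (act L n))) _ _) => x.
- exact: mqn_src (mqidN (act L n)) x.
- exact: mqn_tgt (mqidN (act L n)) x.
Defined.

Lemma id_phiE n x : id_phi n x = idm (act L n x).
Proof. by rewrite /id_phi; cbn [mqn]; rewrite recastNE. Qed.

Lemma boxN_id_phi n m (f : osk n m) x :
  boxN (fun j => id_phi (fib f j)) (regroupF (smquiv L) f x)
  = idm (actf (act L) f x).
Proof.
apply: Box_eq => h b; first by [].
exact: id_phiE.
Qed.

Lemma id_phi_rho x :
  vcmp (whiskl (mqid (smquiv L)) (rho L)) (id_phi 1) x
  = whiskr (rho L) (boxF (fun _ : 'I_1 => mqid (smquiv L))) x.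
Proof.
rewrite vcmpE id_phiE whiskrE (proj1 (boxF_mqid _)).
by rewrite tcmp_idr // fdom nt_dom.
Qed.

Lemma id_phi_lam n m (f : osk n m) x :
  vcmp (whiskr (id_phi m) (actf (act L) f))
    (convN (box_actf (mqid (smquiv L)) f)
      (vcmp
        (whiskl (act L m)
          (whiskr (boxN (fun j => id_phi (fib f j)))
            (regroupF (smquiv L) f)))
        (convN (actf_box (mqid (smquiv L)) f)
          (whiskr (lam L f)
            (boxF (fun _ : 'I_n => mqid (smquiv L))))))) x
  = vcmp (whiskl (mqid (smquiv L)) (lam L f)) (id_phi n) x.
Proof.
cbn [vcmp nt convN whiskl whiskr].
rewrite [LHS]cmpE [X in _ \oo X]cmpE [RHS]cmpE.
(* Every [phi] is an identity, so both sides reduce to [lam L f x]. *)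
rewrite boxN_id_phi !id_phiE (proj1 (boxF_mqid _)) fidm.
by rewrite !tcmp_idl ?tcmp_idr // ?lam_dom ?lam_cod.
Qed.

Definition multifun_id : multifun L L :=
  @Multifun L L (idF (smbase L)) (mqid (smquiv L)) id_phi id_phi_rho id_phi_lam.

End IdentityMultifun.

(** * Identities, vertical and horizontal composites of 2-cells *)

Lemma mn_phi_id (L M : laxsmc) (F : multifun L M) n x :
  vcmp (phi F n) (whiskl (act M n) (boxN (fun _ : 'I_n => mqidN (mfquiv F)))) x
  = vcmp (whiskr (mqidN (mfquiv F)) (act L n)) (phi F n) x.
Proof.
rewrite 2!vcmpE whisklE whiskrE boxN_id fidm tcmp_idr ?phi_dom //.
by rewrite [RHS]tcmp_idl ?phi_cod.
Qed.

Definition multinat_id (L M : laxsmc) (F : multifun L M) : multinat F F :=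
  @Multinat L M F F (idN (mfbase F)) (mqidN (mfquiv F)) (mn_phi_id F).

(** Boxing preserves vertical composition, so [phi] moves first past [b] and then past [a], by the
    square of each. *)
Lemma mn_phi_vcmp (L M : laxsmc) (F G H : multifun L M) (b : multinat G H)
    (a : multinat F G) n x :
  vcmp (phi H n)
    (whiskl (act M n) (boxN (fun _ : 'I_n => mqvcmp (mnquiv b) (mnquiv a)))) x
  = vcmp (whiskr (mqvcmp (mnquiv b) (mnquiv a)) (act L n)) (phi F n) x.
Proof.
rewrite 2!vcmpE whisklE whiskrE boxN_vcmp ftcmp ?nt_dom ?nt_cod //.
rewrite tcmpA ?phi_dom ?fcod ?fdom ?nt_cod ?nt_dom // mn_phiE.
rewrite -tcmpA ?nt_dom ?phi_cod // ?phi_dom ?fcod ?nt_cod // mn_phiE.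
by rewrite tcmpA ?nt_dom ?nt_cod // vcmpE.
Qed.

Definition multinat_vcmp (L M : laxsmc) (F G H : multifun L M)
  (b : multinat G H) (a : multinat F G) : multinat F H :=
  @Multinat L M F H (vcmp (mnbase b) (mnbase a)) (mqvcmp (mnquiv b) (mnquiv a))
    (mn_phi_vcmp b a).

Lemma mqhcmpE (C D E : category) (v v' : functor D E) (u u' : functor C D)
  (t : nattrans v v') (s : nattrans u u')
  (X : mquiver C) (Y : mquiver D) (Z : mquiver E) (G : mqfun v Y Z)
  (G' : mqfun v' Y Z) (F : mqfun u X Y) (F' : mqfun u' X Y)
  (b : mqnat t G G') (a : mqnat s F F') x :
  mqhcmp b a x = b (F' x) \oo fmor G (a x).
Proof. exact: cmpE. Qed.

Lemma multifun_compE (L M N : laxsmc) (G : multifun M N) (F : multifun L M)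
    n x :
  phi (multifun_comp G F) n x
  = fmor (mfquiv G) (phi F n x) \oo phi G n (boxF (fun _ : 'I_n => mfquiv F) x).
Proof. exact: mqcomp_phiE. Qed.

(** Four squares are pasted: that of [b] at the box of [F'], naturality of [phi G] at the boxed [a],
    naturality of [b] at [phi F'], and that of [a] under [G]. *)
Lemma mn_phi_hcmp (L M N : laxsmc) (G G' : multifun M N) (F F' : multifun L M)
    (b : multinat G G') (a : multinat F F') n x :
  vcmp (phi (multifun_comp G' F') n)
    (whiskl (act N n) (boxN (fun _ : 'I_n => mqhcmp (mnquiv b) (mnquiv a)))) x
  = vcmp (whiskr (mqhcmp (mnquiv b) (mnquiv a)) (act L n))
      (phi (multifun_comp G F) n) x.
Proof.
rewrite 2!vcmpE whisklE whiskrE mqhcmpE !multifun_compE boxN_hcmp.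
rewrite ftcmp ?fcod ?nt_dom ?nt_cod //.
pose y := boxN (fun _ : 'I_n => mnquiv a) x; rewrite -/y.
have dy : dom y = boxF (fun _ : 'I_n => mfquiv F) x by exact: nt_dom.
have cy : cod y = boxF (fun _ : 'I_n => mfquiv F') x by exact: nt_cod.
have E1 := phi_nat G y; rewrite dy cy in E1.
have E2 := nt_tcmp (mnquiv b) (phi F' n x); rewrite phi_dom phi_cod in E2.
(* The first two squares bring [phi G] to the right end. *)
transitivity (fmor (mfquiv G') (phi F' n x)
  \oo (mnquiv b (act M n (boxF (fun _ : 'I_n => mfquiv F') x))
  \oo (fmor (mfquiv G) (fmor (act M n) y)
  \oo phi G n (boxF (fun _ : 'I_n => mfquiv F) x)))).
  rewrite -E1 -tcmpA; first (rewrite [X in _ \oo X]tcmpA;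
    first (rewrite mn_phiE -[X in _ \oo X]tcmpA //)).
  - by rewrite nt_dom phi_cod.
  - by rewrite phi_dom !fcod cy.
  - by rewrite phi_dom fcod nt_cod.
  - by rewrite fdom nt_dom !fcod cy.
  - exact: comp_phi_composable.
  - rewrite cod_tcmp; first by rewrite phi_dom fcod nt_cod.
    by rewrite fdom nt_dom !fcod cy.
rewrite tcmpA; first last.
- by rewrite cod_tcmp ?fcod ?nt_dom ?cy // !fdom phi_cod dy.
- by rewrite fdom phi_dom nt_cod.
(* Moving [b] to the left end puts the images under [G] of [phi F'] and of the boxed [a] side by
   side, ready for the square of [a]. *)
rewrite -E2 -[LHS]tcmpA; first last.
- by rewrite cod_tcmp ?fdom ?phi_dom ?fcod ?cy // phi_cod dy.
- by rewrite nt_dom fcod phi_cod.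
rewrite [X in _ \oo X]tcmpA; first last.
- by rewrite !fdom phi_cod dy.
- by rewrite fdom phi_dom !fcod cy.
rewrite -ftcmp; last by rewrite phi_dom fcod cy.
rewrite mn_phiE ftcmp; last by rewrite nt_dom phi_cod.
rewrite -[X in _ \oo X]tcmpA ?fdom ?fcod ?phi_cod ?phi_dom ?nt_dom //.
by rewrite tcmpA ?cod_tcmp ?fdom ?fcod ?phi_cod ?phi_dom ?nt_dom ?nt_cod.
Qed.

Definition multinat_hcmp (L M N : laxsmc) (G G' : multifun M N)
  (F F' : multifun L M) (b : multinat G G') (a : multinat F F') :
  multinat (multifun_comp G F) (multifun_comp G' F') :=
  @Multinat L N (multifun_comp G F) (multifun_comp G' F')
    (hcmp (mnbase b) (mnbase a)) (mqhcmp (mnquiv b) (mnquiv a))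
    (mn_phi_hcmp b a).

(** * Unit and associativity laws of 1-cells *)

Lemma multifun_comp_idl (L M : laxsmc) (F : multifun L M) :
  multifun_comp (multifun_id M) F = F.
Proof.
apply: multifun_eq => [||n x]; [by []|by []|].
by rewrite multifun_compE id_phiE tcmp_idr ?fdom ?phi_dom.
Qed.

Lemma multifun_comp_idr (L M : laxsmc) (F : multifun L M) :
  multifun_comp F (multifun_id L) = F.
Proof.
apply: multifun_eq => [||n x]; [by []|by []|].
rewrite multifun_compE id_phiE fidm (proj1 (boxF_mqid _)).
by rewrite tcmp_idl ?phi_cod.
Qed.

Lemma multifun_compA (K L M N : laxsmc) (H : multifun M N) (G : multifun L M)
    (F : multifun K L) :
  multifun_comp H (multifun_comp G F) = multifun_comp (multifun_comp H G) F.
Proof.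
apply: multifun_eq => [||n x]; [by []|by []|].
rewrite [LHS]multifun_compE [RHS]multifun_compE.
rewrite [in LHS]multifun_compE [phi (multifun_comp H G) _ _]multifun_compE.
rewrite ftcmp ?comp_phi_composable //.
(* The left side evaluates [phi H] at the box of the composite, the right side at the composite of
   the boxes. *)
have [eo _] := boxF_cmp (fun _ : 'I_n => mfquiv G) (fun _ : 'I_n => mfquiv F).
rewrite [boxF (fun _ : 'I_n => mfquiv (multifun_comp G F)) x]eo -[LHS]tcmpA //.
  by rewrite fdom comp_phi_composable fcod.
exact: comp_phi_composable.
Qed.

(** * Componentwise laws of natural transformations *)

Lemma vcmp_idl (C D : category) (F G : functor C D) (a : nattrans F G) x :
  vcmp (idN G) a x = a x.
Proof. by rewrite vcmpE tcmp_idl ?nt_cod. Qed.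

Lemma vcmp_idr (C D : category) (F G : functor C D) (a : nattrans F G) x :
  vcmp a (idN F) x = a x.
Proof. by rewrite vcmpE tcmp_idr ?nt_dom. Qed.

Lemma vcmpA (C D : category) (F G H K : functor C D) (c : nattrans H K)
    (b : nattrans G H) (a : nattrans F G) x :
  vcmp c (vcmp b a) x = vcmp (vcmp c b) a x.
Proof. by rewrite !vcmpE tcmpA ?nt_dom ?nt_cod. Qed.

Lemma hcmp_idN (C D E : category) (G : functor D E) (F : functor C D) x :
  hcmp (idN G) (idN F) x = idN (cmpF G F) x.
Proof. by rewrite hcmpE /= fidm tcmp_idl ?cod_idm. Qed.

Lemma hcmp_vcmp (C D E : category) (G G' G'' : functor D E)
    (F F' F'' : functor C D) (b' : nattrans G' G'') (b : nattrans G G')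
    (a' : nattrans F' F'') (a : nattrans F F') x :
  hcmp (vcmp b' b) (vcmp a' a) x = vcmp (hcmp b' a') (hcmp b a) x.
Proof.
rewrite hcmpE [RHS]vcmpE (hcmpE b' a') (hcmpE b a) (vcmpE b' b) (vcmpE a' a).
rewrite ftcmp ?nt_dom ?nt_cod //.
(* This is the only exchange of factors; everything else is associativity. *)
have N : b (F'' x) \oo fmor G (a' x) = fmor G' (a' x) \oo b (F' x).
  by have := nt_tcmp b (a' x); rewrite nt_cod nt_dom.
have e1 : dom (fmor G (a' x)) = cod (fmor G (a x)).
  by rewrite fdom fcod nt_dom nt_cod.
have e2 : dom (b (F'' x)) = cod (fmor G (a' x)) by rewrite nt_dom fcod nt_cod.
have e3 : dom (b' (F'' x)) = cod (b (F'' x)) by rewrite nt_dom nt_cod.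
have e4 : dom (b' (F'' x)) = cod (fmor G' (a' x)).
  by rewrite nt_dom fcod nt_cod.
have e5 : dom (fmor G' (a' x)) = cod (b (F' x)) by rewrite fdom nt_dom nt_cod.
have e6 : dom (b (F' x)) = cod (fmor G (a x)) by rewrite nt_dom fcod nt_cod.
rewrite -(@tcmpA _ (b' (F'' x)) (b (F'' x))) ?cod_tcmp //.
rewrite (@tcmpA _ (b (F'' x))) // N.
by rewrite -!tcmpA ?cod_tcmp ?dom_tcmp.
Qed.

Lemma hcmp_idl (C D : category) (F G : functor C D) (a : nattrans F G) x :
  hcmp (idN (idF D)) a x = a x.
Proof. by rewrite hcmpE tcmp_idl //= nt_cod. Qed.

Lemma hcmp_idr (C D : category) (F G : functor C D) (a : nattrans F G) x :
  hcmp a (idN (idF C)) x = a x.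
Proof. by rewrite hcmpE /= fidm tcmp_idr ?nt_dom. Qed.

Lemma hcmpA (B C D E : category) (H H' : functor D E) (G G' : functor C D)
    (F F' : functor B C) (c : nattrans H H') (b : nattrans G G')
    (a : nattrans F F') x :
  hcmp c (hcmp b a) x = hcmp (hcmp c b) a x.
Proof.
by rewrite !hcmpE ftcmp ?tcmpA ?fdom ?fcod ?nt_dom ?nt_cod.
Qed.

(** * Assembly of the 2-category *)

(** It is kept transparent so that its compositions compute in the theorem. *)
Definition span_multicategories : two_category multinat.
Proof.
refine (@TwoCategory laxsmc multifun multinat multifun_id multifun_comp
  multinat_id multinat_vcmp multinat_hcmp _ _ _ _ _ multifun_comp_idl
  multifun_comp_idr multifun_compA _ _ _).
(* Each law is checked on the base and on the multiquiver components, by the same law of natural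
   transformations. *)
- by move=> L M F G a; apply: multinat_eq => x; exact: vcmp_idl.
- by move=> L M F G a; apply: multinat_eq => x; exact: vcmp_idr.
- by move=> L M F G H K c b a; apply: multinat_eq => x; exact: vcmpA.
- by move=> L M N G F; apply: multinat_eq => x; exact: hcmp_idN.
- by move=> *; apply: multinat_eq => x; exact: hcmp_vcmp.
(* From here on the two sides have different end 1-cells; their equalities are the first two
   goals. *)
- move=> L M F G a; apply: multinat_cell_eq => [||x|x].
  + exact: multifun_comp_idl.
  + exact: multifun_comp_idl.
  + exact: hcmp_idl.
  + exact: hcmp_idl.
- move=> L M F G a; apply: multinat_cell_eq => [||x|x].
  + exact: multifun_comp_idr.
  + exact: multifun_comp_idr.
  + exact: hcmp_idr.
  + exact: hcmp_idr.
- move=> *; apply: multinat_cell_eq => [||x|x].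
  + exact: multifun_compA.
  + exact: multifun_compA.
  + exact: hcmpA.
  + exact: hcmpA.
Defined.

Theorem proposition1p15 :
  exists K : two_category multinat,
    (forall (L M N : laxsmc) (G : multifun M N) (F : multifun L M),
      [/\ feq (mfbase (comp1 K G F)) (cmpF (mfbase G) (mfbase F)),
          feq (mfquiv (comp1 K G F)) (cmpF (mfquiv G) (mfquiv F))
        & forall n x, phi (comp1 K G F) n x = comp_phi G F n x]) /\
    (forall (L M : laxsmc) (F G H : multifun L M)
        (b : multinat G H) (a : multinat F G),
      (forall x, mnbase (vcomp K b a) x = vcmp (mnbase b) (mnbase a) x) /\
      (forall x, mnquiv (vcomp K b a) x = vcmp (mnquiv b) (mnquiv a) x)) /\
    (forall (L M N : laxsmc) (G G' : multifun M N) (F F' : multifun L M)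
        (b : multinat G G') (a : multinat F F'),
      (forall x, mnbase (hcomp K b a) x = hcmp (mnbase b) (mnbase a) x) /\
      (forall x, mnquiv (hcomp K b a) x = hcmp (mnquiv b) (mnquiv a) x)).
Proof.
exists span_multicategories; split; [|split].
- move=> L M N G F; split; [by []|by []|move=> n x].
  by rewrite comp_phiE; exact: multifun_compE.
- by [].
- by [].
Qed.
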